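(* Let $\mathrm{D}\subset\mathbb{R}^d$, $d\ge2$, be a bounded, contractible, polytopal Lipschitz domain, let $\mathcal{T}$ be a regular, simplicial triangulation of $\mathrm{D}$, and let $\mathbb{W}=\mathbb{V}_\bullet(\mathrm{D})\in\{\mathbb{V}_\bullet^{(1)},\mathbb{V}_\bullet^{(2)},\mathbb{V}_\bullet^{(3)}\}$ be one of the finite element spaces on $\mathcal{T}$ (with $\mathbb{V}_\bullet^{(3)}$ excluded if $d>3$). Let $\mathbb{V}(\mathrm{D})\supset\mathbb{V}_\bullet(\mathrm{D})$ be the corresponding Hilbertian Sobolev space, let $\mathbb{L}(\mathrm{D})=L^2(\mathrm{D}_1)\times\dots\times L^2(\mathrm{D}_n)$ with $n\ge 1$ and bounded, contractible, polytopal Lipschitz domains $\mathrm{D}_1,\dots,\mathrm{D}_n$, and let $\boldsymbol{L}:\mathbb{V}(\mathrm{D})\to\mathbb{L}(\mathrm{D})$ be a bounded linear operator for which there are constants $0<c_{\boldsymbol{L}}\le C_{\boldsymbol{L}}<\infty$ with $$c_{\boldsymbol{L}}\|v\|_{\mathbb{V}(\mathrm{D})}\le\|\boldsymbol{L}v\|_{\mathbb{L}(\mathrm{D})}\le C_{\boldsymbol{L}}\|v\|_{\mathbb{V}(\mathrm{D})}\qquad\text{for all }v\in\mathbb{V}(\mathrm{D}).$$ Let $F\in\mathrm{range}(\boldsymbol{L})$ and let $U\in\mathbb{V}(\mathrm{D})$ be the solution of $\boldsymbol{L}U=F$. Then there exists a unique minimizer $$\Phi_\bullet=\mathop{\mathrm{arg\,min}}_{\widetilde\Phi_\bullet\in\mathcal{NN}(\mathbb{W};\mathcal{T},\mathrm{D})}\|F-\boldsymbol{L}\,\mathrm{R}(\widetilde\Phi_\bullet)\|^2_{\mathbb{L}(\mathrm{D})},$$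 and it satisfies $$c_{\boldsymbol{L}}\|U-\mathrm{R}(\Phi_\bullet)\|_{\mathbb{V}(\mathrm{D})}\le\|F-\boldsymbol{L}\,\mathrm{R}(\Phi_\bullet)\|_{\mathbb{L}(\mathrm{D})}=\min_{\widetilde\Phi_\bullet\in\mathcal{NN}(\mathbb{W};\mathcal{T},\mathrm{D})}\|F-\boldsymbol{L}\,\mathrm{R}(\widetilde\Phi_\bullet)\|_{\mathbb{L}(\mathrm{D})}$$ $$\le C_{\boldsymbol{L}}\min_{\widetilde\Phi_\bullet\in\mathcal{NN}(\mathbb{W};\mathcal{T},\mathrm{D})}\|U-\mathrm{R}(\widetilde\Phi_\bullet)\|_{\mathbb{V}(\mathrm{D})}=C_{\boldsymbol{L}}\min_{v_\bullet\in\mathbb{V}_\bullet(\mathrm{D})}\|U-v_\bullet\|_{\mathbb{V}(\mathrm{D})}.$$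
   Context: Neural networks. A neural network $\Phi$ with input dimension $d$ and depth $L\ge1$ is a finite sequence $\Phi=((A_1,b_1,\varrho_1),\dots,(A_L,b_L,\varrho_L))$ of weight matrices $A_\ell\in\mathbb{R}^{N_\ell\times N_{\ell-1}}$ ($N_0=d$), bias vectors $b_\ell\in\mathbb{R}^{N_\ell}$ and lists $\varrho_\ell$ of $N_\ell$ componentwise activation functions, with $\varrho_L$ the identity; its realization is $\mathrm{R}(\Phi):x\mapsto x_L$ with $x_0=x$, $x_\ell=\varrho_\ell(A_\ell x_{\ell-1}+b_\ell)$. Realizations are considered on $\mathrm{D}$ and identified with elements of function spaces up to a.e. equality. Triangulations. A regular, simplicial triangulation $\mathcal{T}$ of $\mathrm{D}$ is a finite set of closed $d$-simplices with union $\overline{\mathrm{D}}$ and pairwise disjoint interiors, such that the intersection of any two distinct elements, if nonempty, is a common subsimplex. Finite element spaces. On $\mathcal{T}$: $\mathrm{S}_1$ is the space of continuous functions that are affine on each $K\in\mathcal{T}$; $\mathrm{RT}_0$ is the lowest order Raviart–Thomas space; $\mathrm{N}_0$ is the lowest order Nédélec space (of the first kind). The spaces and the corresponding $\mathbb{V}(\mathrm{D})$, equipped with a Hilbertian norm $\|\cdot\|_{\mathbb{V}(\mathrm{D})}$, are - $\mathbb{V}_\bullet^{(1)}=(\mathrm{S}_1\cap H^1_0(\mathrm{D}))\times\mathrm{RT}_0\subset\mathbb{V}(\mathrm{D})=H^1_0(\mathrm{D})\times H(\mathrm{div};\mathrm{D})$; - $\mathbb{V}_\bullet^{(2)}=(\mathrm{S}_1\cap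 H^1_0(\mathrm{D}))^d\times\mathrm{RT}_0^d\subset\mathbb{V}(\mathrm{D})=H^1_0(\mathrm{D})^d\times H(\mathrm{div};\mathrm{D})^d$; - $\mathbb{V}_\bullet^{(3)}=(\mathrm{N}_0\cap H_0(\mathrm{curl};\mathrm{D}))\times\mathrm{N}_0\subset\mathbb{V}(\mathrm{D})=H_0(\mathrm{curl};\mathrm{D})\times H(\mathrm{curl};\mathrm{D})$, where $H_0(\mathrm{curl};\mathrm{D})$ denotes the fields in $H(\mathrm{curl};\mathrm{D})$ with vanishing tangential trace. FoSLS neural networks. $\mathcal{NN}(\mathbb{W};\mathcal{T},\mathrm{D})=\{\Phi^{\mathbb{W},v}:v\in\mathbb{W}(\mathcal{T},\mathrm{D})\}$ is a set of neural networks with ReLU ($x\mapsto\max\{0,x\}$) and BiSU ($x\mapsto1$ if $x>0$, $x\mapsto0$ if $x\le0$) activations, containing for each $v\in\mathbb{W}(\mathcal{T},\mathrm{D})$ one network $\Phi^{\mathbb{W},v}$ of depth $5$ whose realization equals $v$ a.e. in $\mathrm{D}$ (all components of $v$ being output in parallel). With the operation $\Phi^{\mathbb{W},v}\,\widehat{+}\,\lambda\Phi^{\mathbb{W},w}:=\Phi^{\mathbb{W},v+\lambda w}$ it is a finite-dimensional vector space, and $\mathrm{R}:\mathcal{NN}(\mathbb{W};\mathcal{T},\mathrm{D})\to\mathbb{W}(\mathcal{T},\mathrm{D})$ is a linear bijection. *)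

(* Defs.v *)
From HB Require Import structures.
From mathcomp Require Import all_boot all_order all_algebra.
From mathcomp Require Import all_classical all_reals all_analysis.
Set Implicit Arguments.
Unset Strict Implicit.
Unset Printing Implicit Defensive.
Import Order.TTheory GRing.Theory Num.Theory.
Import numFieldNormedType.Exports.
Local Open Scope classical_set_scope.
Local Open Scope ring_scope.

(** Lebesgue measure on ['rV[R]_n]: the sigma-algebra is the one generated by
    the coordinate maps (i.e. the Borel one); the measure is the n-fold product
    of the Lebesgue measure of [R]. *)

Definition measure_rV_display : measure_display.
Proof. exact: default_measure_display. Qed.

Section measurable_rV.
Context (R : realType) (n : nat).

Let coords (i : 'I_n) (x : 'rV[R]_n) : measurableTypeR R := x 0 i.

Let rV_set0 : g_sigma_preimage coords set0.
Proof. exact: sigma_algebra0. Qed.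

Let rV_setC A : g_sigma_preimage coords A -> g_sigma_preimage coords (~` A).
Proof. exact: sigma_algebraC. Qed.

Let rV_bigcup (F : _^nat) : (forall i, g_sigma_preimage coords (F i)) ->
  g_sigma_preimage coords (\bigcup_i (F i)).
Proof. exact: sigma_algebra_bigcup. Qed.

HB.instance Definition _ := @isMeasurable.Build measure_rV_display
  'rV[R]_n (g_sigma_preimage coords) rV_set0 rV_setC rV_bigcup.

End measurable_rV.

Section lebesgue_rV.
Context (R : realType).

Lemma measurable_coord n (i : 'I_n) :
  measurable_fun setT (fun x : 'rV[R]_n => x 0 i : measurableTypeR R).
Proof.
move=> _ Y mY; rewrite setTI; apply: sub_sigma_algebra => /=.
rewrite -bigcup_seq/=; exists i => /=; first by rewrite mem_index_enum.
by exists Y => //; rewrite setTI.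
Qed.

Lemma measurable_fun_rVP d (T : measurableType d) n (f : T -> 'rV[R]_n) :
  (forall i, measurable_fun setT (fun x => f x 0 i : measurableTypeR R)) ->
  measurable_fun setT f.
Proof.
move=> mf _ A mA; rewrite setTI; move: A mA.
apply: smallest_sub.
  split; first by rewrite preimage_set0; exact: measurable0.
  - by move=> A mA; rewrite setTD preimage_setC; exact: measurableC.
  - by move=> F mF; rewrite preimage_bigcup; exact: bigcup_measurable.
rewrite -bigcup_seq => A [i _ [B mB <-]].
by rewrite setTI; have := mf i measurableT B mB; rewrite setTI.
Qed.

Definition rV_cons n (p : measurableTypeR R * 'rV[R]_n) : 'rV[R]_n.+1 :=
  row_mx (p.1)%:M p.2 : 'rV[R]_(1 + n).

Lemma measurable_rV_cons n : measurable_fun setT (@rV_cons n).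
Proof.
apply: measurable_fun_rVP => i.
case: (unliftP ord0 i) => [j ->|->].
- rewrite (_ : (fun _ => _) = (fun y : 'rV[R]_n => y 0 j) \o snd).
    by apply: measurableT_comp; [exact: measurable_coord|exact: measurable_snd].
  apply/funext => x /=; rewrite /rV_cons -[RHS](row_mxEr (x.1)%:M) /=.
  by congr (row_mx _ _ _ _); apply/val_inj.
- rewrite (_ : (fun _ => _) = fst); first exact: measurable_fst.
  apply/funext => x /=; rewrite /rV_cons.
  have -> : ord0 = lshift n (ord0 : 'I_1) by apply/val_inj.
  by apply: etrans (row_mxEl _ _ _ _) _; rewrite mxE eqxx mulr1n.
Qed.

HB.instance Definition _ n :=
  isMeasurableFun.Build _ _ _ _ (@rV_cons n) (@measurable_rV_cons n).

Section succ.
Variables (n : nat) (m : {sigma_finite_measure set 'rV[R]_n -> \bar R}).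

Definition lebesgue_rV_succ : set 'rV[R]_n.+1 -> \bar R :=
  pushforward (lebesgue_measure \x m)%E (@rV_cons n).

Let succ0 : lebesgue_rV_succ set0 = 0%E.
Proof. exact: measure0. Qed.

Let succ_ge0 A : (0 <= lebesgue_rV_succ A)%E.
Proof. exact: measure_ge0. Qed.

Let succ_sigma_additive : semi_sigma_additive lebesgue_rV_succ.
Proof. exact: measure_semi_sigma_additive. Qed.

HB.instance Definition _ := isMeasure.Build _ _ _ lebesgue_rV_succ
  succ0 succ_ge0 succ_sigma_additive.

Let succ_sigma_finite : sigma_finite setT lebesgue_rV_succ.
Proof.
have [F FT mF] : sigma_finite setT (lebesgue_measure \x m)%E.
  have /sigma_finiteP[F [TF ndF Foo]] := sigma_finiteT (@lebesgue_measure R).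
  have /sigma_finiteP[G [TG ndG Goo]] := sigma_finiteT m.
  exists (fun k => F k `*` G k).
    rewrite -setXTT TF TG predeqE => -[x y]; split.
      move=> [/= [i _ Fix] [j _ Gjy]]; exists (maxn i j) => //; split.
        by move: x Fix; exact/subsetPset/ndF/leq_maxl.
      by move: y Gjy; exact/subsetPset/ndG/leq_maxr.
    by move=> [i _ []/= ? ?]; split; exists i.
  move=> k; have [? ?] := Foo k; have [? ?] := Goo k.
  split; first exact: measurableX.
  by rewrite product_measure1E// lte_mul_pinfty// ge0_fin_numE.
pose tl (x : 'rV[R]_n.+1) : measurableTypeR R * 'rV[R]_n :=
  (x 0 0, \row_i x 0 (lift ord0 i)).
have tlK : cancel (@rV_cons n) tl.
  move=> [a y]; congr pair => /=.
    have -> : 0 = lshift n (ord0 : 'I_1) by apply/val_inj.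
    by apply: etrans (row_mxEl _ _ _ _) _; rewrite mxE eqxx mulr1n.
  apply/rowP => i; rewrite mxE.
  have -> : lift ord0 i = rshift 1 i by apply/val_inj.
  exact: row_mxEr.
have mtl : measurable_fun setT tl.
  apply: measurable_fun_pair; first exact: measurable_coord.
  apply: measurable_fun_rVP => i.
  rewrite (_ : (fun _ => _) = fun x : 'rV[R]_n.+1 => x 0 (lift ord0 i)).
    exact: measurable_coord.
  by apply/funext => x; rewrite /= mxE.
exists (fun k => tl @^-1` F k).
  by rewrite -preimage_bigcup -FT preimage_setT.
move=> k; split.
  by rewrite -[X in measurable X]setTI; apply: mtl => //; exact: (mF k).1.
rewrite /lebesgue_rV_succ /pushforward -comp_preimage.
rewrite (_ : tl \o _ = id) ?preimage_id; first exact: (mF k).2.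
by apply/funext => p; rewrite /= tlK.
Qed.

HB.instance Definition _ := Measure_isSigmaFinite.Build _ _ _ lebesgue_rV_succ
  succ_sigma_finite.

End succ.

Lemma sigma_finite_dirac d (T : measurableType d) (a : T) :
  sigma_finite setT (@dirac d T a R).
Proof.
apply: fin_num_fun_sigma_finite; first by rewrite measure0.
by move=> A mA; rewrite diracE.
Qed.

HB.instance Definition _ d (T : measurableType d) (a : T) :=
  Measure_isSigmaFinite.Build d T R (@dirac d T a R) (sigma_finite_dirac a).

Fixpoint lebesgue_rV n : {sigma_finite_measure set 'rV[R]_n -> \bar R} :=
  match n with
  | 0 => @dirac _ 'rV[R]_0 0 R
  | n'.+1 => lebesgue_rV_succ (lebesgue_rV n')
  end.

End lebesgue_rV.

Section domains.
Context (R : realType) (d : nat).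
Implicit Types (D K : set 'rV[R]_d) (T : set (set 'rV[R]_d)).

Definition conv_hull k (p : 'I_k -> 'rV[R]_d) (I : {set 'I_k}) : set 'rV[R]_d :=
  [set x | exists a : 'I_k -> R,
    [/\ forall i, 0 <= a i, \sum_(i in I) a i = 1
      & x = \sum_(i in I) a i *: p i]].

Definition affinely_independent k (p : 'I_k -> 'rV[R]_d) :=
  forall a : 'I_k -> R,
    \sum_i a i = 0 -> \sum_i a i *: p i = 0 -> forall i, a i = 0.

Definition is_polytope K :=
  exists k (p : 'I_k -> 'rV[R]_d), K = conv_hull p [set: 'I_k].

Definition is_simplex K :=
  exists2 p : 'I_d.+1 -> 'rV[R]_d,
    affinely_independent p & K = conv_hull p [set: 'I_d.+1].

Definition is_subsimplex S K :=
  exists (p : 'I_d.+1 -> 'rV[R]_d) (I : {set 'I_d.+1}),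
    [/\ affinely_independent p, K = conv_hull p [set: 'I_d.+1]
      & S = conv_hull p I].

Definition contractible D :=
  exists x0, D x0 /\ exists H : R * 'rV[R]_d -> 'rV[R]_d,
    [/\ {within `[0, 1] `*` D, continuous H},
        forall t x, 0 <= t <= 1 -> D x -> D (H (t, x)),
        forall x, D x -> H (0, x) = x
      & forall x, D x -> H (1, x) = x0].

(** Near each boundary point [p], in Cartesian coordinates [y] obtained by a
    rigid motion, [D] is the strict subgraph of a Lipschitz function of all
    the coordinates but the [j]-th. *)
Definition lipschitz_boundary D :=
  forall p, closure D p -> ~ D p ->
    exists (Q : 'M[R]_d) (j : 'I_d) (f : 'rV[R]_d.-1 -> R),
      [/\ Q *m Q^T = 1%:M, lipschitz f
        & \forall x \near p, let y := (x - p) *m Q in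
            D x <-> y 0 j < f (col' j y)].

Definition polytopal D :=
  exists P : set (set 'rV[R]_d),
    [/\ finite_set P, forall K, P K -> is_polytope K
      & closure D = \bigcup_(K in P) K].

(** Contractible sets are nonempty and connected, so that [D] is a domain. *)
Definition polytopal_lipschitz_domain D :=
  [/\ open D, bounded_set D, contractible D, polytopal D
    & lipschitz_boundary D].

Definition regular_triangulation D T :=
  [/\ finite_set T, forall K, T K -> is_simplex K,
      \bigcup_(K in T) K = closure D,
      forall K K', T K -> T K' -> K <> K' -> interior K `&` interior K' = set0
    & forall K K', T K -> T K' -> K <> K' -> K `&` K' !=set0 ->
        is_subsimplex (K `&` K') K /\ is_subsimplex (K `&` K') K'].

End domains.

(** Function spaces on [D] consist of functions on the whole of ['rV[R]_d], the
    values outside [D] being irrelevant; they are invariant under a.e. equality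
    in [D] (of measurable functions), and elements that are a.e. equal in [D]
    are identified. *)
Section function_spaces.
Context (R : realType) (d : nat).
Implicit Types (D : set 'rV[R]_d) (u phi : 'rV[R]_d -> R).
Implicit Types (v : 'rV[R]_d -> 'rV[R]_d).

Local Notation mu := (lebesgue_rV R d).

Definition L2 D u : Prop := u \_ D \in Lfun mu 2%:E.

Definition L2norm D u : R := fine 'N[mu]_2%:E[EFin \o (u \_ D)].

Definition partial (i : 'I_d) u : 'rV[R]_d -> R := 'D_(delta_mx 0 i) u.

Definition smooth u :=
  forall (s : seq 'I_d) x, differentiable (foldr partial u s) x.

(** $C_c^\infty(D)$; with [D := setT], $C_c^\infty(\mathbb{R}^d)$. *)
Definition test_function D phi :=
  smooth phi /\ exists K, [/\ compact K, K `<=` D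
                            & forall x, ~ K x -> phi x = 0].

Definition weak_grad D u (g : 'I_d -> 'rV[R]_d -> R) :=
  (forall i, L2 D (g i)) /\
  forall i phi, test_function D phi ->
    \int[mu]_(x in D) (u x * partial i phi x)
      = - \int[mu]_(x in D) (g i x * phi x).

Definition weak_div D v (g : 'rV[R]_d -> R) :=
  L2 D g /\
  forall phi, test_function D phi ->
    \int[mu]_(x in D) (\sum_i v x 0 i * partial i phi x)
      = - \int[mu]_(x in D) (g x * phi x).

(** The curl is the family $(\partial_i v_j - \partial_j v_i)_{i<j}$: one scalar
    if [d = 2], and the components of the usual vector field up to order and
    sign if [d = 3]. The formula is required for the test functions of the
    domain [D']. *)
Definition curl_formula D' D v (g : 'I_d -> 'I_d -> 'rV[R]_d -> R) :=
  (forall i j : 'I_d, (i < j)%N -> L2 D (g i j)) /\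
  forall (i j : 'I_d) phi, (i < j)%N -> test_function D' phi ->
    \int[mu]_(x in D) (v x 0 j * partial i phi x - v x 0 i * partial j phi x)
      = - \int[mu]_(x in D) (g i j x * phi x).

Definition weak_curl D := curl_formula D D.

(** $H^1_0(D)$: the closure of $C_c^\infty(D)$ in $H^1(D)$. *)
Definition H10 D u :=
  L2 D u /\ exists g, weak_grad D u g /\
    forall eps, 0 < eps -> exists phi, test_function D phi /\
      L2norm D (fun x => u x - phi x) ^+ 2
        + \sum_i L2norm D (fun x => g i x - partial i phi x) ^+ 2 < eps.

Definition Hdiv D v :=
  (forall i, L2 D (fun x => v x 0 i)) /\ exists g, weak_div D v g.

Definition Hcurl D v :=
  (forall i, L2 D (fun x => v x 0 i)) /\ exists g, weak_curl D v g.

(** The tangential trace of $v\in H(\mathrm{curl};D)$ is defined by Green's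
    formula, as the functional sending $\varphi\in H^1(D)$ to
    $\int_D (\mathrm{curl}\,v)_{ij}\varphi
       + \int_D (v_j\partial_i\varphi - v_i\partial_j\varphi)$,
    which vanishes iff it vanishes on the restrictions to $D$ of
    $C_c^\infty(\mathbb{R}^d)$, dense in $H^1(D)$. *)
Definition H0curl D v :=
  (forall i, L2 D (fun x => v x 0 i)) /\
  exists g, weak_curl D v g /\ curl_formula setT D v g.

Definition H1_sqnorm D u : R :=
  let g := get [set g | weak_grad D u g] in
  L2norm D u ^+ 2 + \sum_i L2norm D (g i) ^+ 2.

Definition Hdiv_sqnorm D v : R :=
  let g := get [set g | weak_div D v g] in
  \sum_i L2norm D (fun x => v x 0 i) ^+ 2 + L2norm D g ^+ 2.

Definition Hcurl_sqnorm D v : R :=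
  let g := get [set g | weak_curl D v g] in
  \sum_i L2norm D (fun x => v x 0 i) ^+ 2
    + \sum_(i < d) \sum_(j < d | (i < j)%N) L2norm D (g i j) ^+ 2.

Variable T : set (set 'rV[R]_d).

Definition S1 D u :=
  exists w : 'rV[R]_d -> R,
    [/\ {within closure D, continuous w},
        forall K, T K -> exists (a : 'rV[R]_d) (b : R),
          forall x, K x -> w x = \sum_i a 0 i * x 0 i + b
      & u = w %[ae mu in D]].

Definition RT0 D v :=
  Hdiv D v /\
  forall K, T K -> exists (a : 'rV[R]_d) (b : R),
    v = (fun x => a + b *: x) %[ae mu in D `&` K].

(** If [d = 3], the maps [fun x => x *m B] with [B] antisymmetric are the maps
    $x\mapsto b\times x$; if [d = 2], the multiples of $x\mapsto(-x_2,x_1)$. *)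
Definition N0 D v :=
  Hcurl D v /\
  forall K, T K -> exists (a : 'rV[R]_d) (B : 'M[R]_d),
    B^T = - B /\ v = (fun x => a + x *m B) %[ae mu in D `&` K].

End function_spaces.

Inductive fosls_case := GradDiv | GradDivSystem | CurlCurl.

(** Number of scalar components of the elements of the product spaces; the
    first factor comes first, and a d-tuple of vector fields is stored as the
    [mxvec] of the matrix having them as rows. *)
Definition fosls_dim (c : fosls_case) (d : nat) : nat :=
  match c with
  | GradDiv => 1 + d
  | GradDivSystem => d + d * d
  | CurlCurl => d + d
  end.

Section fosls_spaces.
Context (R : realType) (d : nat).
Implicit Types (D : set 'rV[R]_d).

Local Notation mu := (lebesgue_rV R d).
Local Notation field c := ('rV[R]_d -> 'rV[R]_(fosls_dim c d)).

Definition sobolev_space (c : fosls_case) D : set (field c) :=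
  match c return set (field c) with
  | GradDiv => [set v : 'rV[R]_d -> 'rV[R]_(1 + d) |
      H10 D (fun x => lsubmx (v x) 0 0) /\ Hdiv D (fun x => rsubmx (v x))]
  | GradDivSystem => [set v : 'rV[R]_d -> 'rV[R]_(d + d * d) |
      forall i, H10 D (fun x => lsubmx (v x) 0 i) /\
                Hdiv D (fun x => row i (vec_mx (rsubmx (v x))))]
  | CurlCurl => [set v : 'rV[R]_d -> 'rV[R]_(d + d) |
      H0curl D (fun x => lsubmx (v x)) /\ Hcurl D (fun x => rsubmx (v x))]
  end.

Definition fe_space (c : fosls_case) (T : set (set 'rV[R]_d)) D :
    set (field c) :=
  match c return set (field c) with
  | GradDiv => [set v : 'rV[R]_d -> 'rV[R]_(1 + d) |
      (S1 T D `&` H10 D) (fun x => lsubmx (v x) 0 0) /\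
      RT0 T D (fun x => rsubmx (v x))]
  | GradDivSystem => [set v : 'rV[R]_d -> 'rV[R]_(d + d * d) |
      forall i, (S1 T D `&` H10 D) (fun x => lsubmx (v x) 0 i) /\
                RT0 T D (fun x => row i (vec_mx (rsubmx (v x))))]
  | CurlCurl => [set v : 'rV[R]_d -> 'rV[R]_(d + d) |
      (N0 T D `&` H0curl D) (fun x => lsubmx (v x)) /\
      N0 T D (fun x => rsubmx (v x))]
  end.

Definition graph_norm (c : fosls_case) D : field c -> R :=
  match c return field c -> R with
  | GradDiv => fun v : 'rV[R]_d -> 'rV[R]_(1 + d) =>
      Num.sqrt (H1_sqnorm D (fun x => lsubmx (v x) 0 0)
                + Hdiv_sqnorm D (fun x => rsubmx (v x)))
  | GradDivSystem => fun v : 'rV[R]_d -> 'rV[R]_(d + d * d) =>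
      Num.sqrt (\sum_i (H1_sqnorm D (fun x => lsubmx (v x) 0 i)
        + Hdiv_sqnorm D (fun x => row i (vec_mx (rsubmx (v x))))))
  | CurlCurl => fun v : 'rV[R]_d -> 'rV[R]_(d + d) =>
      Num.sqrt (Hcurl_sqnorm D (fun x => lsubmx (v x))
                + Hcurl_sqnorm D (fun x => rsubmx (v x)))
  end.

End fosls_spaces.
Arguments sobolev_space {R d} c D _.
Arguments fe_space {R d} c T D _.
Arguments graph_norm {R d} c D _.

(** [N] is induced by an inner product on the space of a.e. classes and
    defines its usual topology (so that the space is complete for [N]); the
    graph norm and, e.g., its weighted variants are instances. *)
Definition hilbertian_norm (R : realType) (d : nat) (c : fosls_case)
    (D : set 'rV[R]_d) (N : ('rV[R]_d -> 'rV[R]_(fosls_dim c d)) -> R) :=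
  let V := sobolev_space c D in
  exists ip : ('rV[R]_d -> 'rV[R]_(fosls_dim c d)) ->
              ('rV[R]_d -> 'rV[R]_(fosls_dim c d)) -> R,
    [/\ forall v w, V v -> V w -> ip v w = ip w v,
        forall a u v w, V u -> V v -> V w ->
          ip (fun x => a *: u x + v x) w = a * ip u w + ip v w,
        forall v, V v -> 0 <= ip v v,
        forall v, V v -> ip v v = 0 <-> v = (fun=> 0) %[ae lebesgue_rV R d in D]
      & (forall v, V v -> N v = Num.sqrt (ip v v)) /\
        exists a b, [/\ 0 < a, 0 < b & forall v, V v ->
          a * graph_norm c D v <= N v <= b * graph_norm c D v]].
Arguments hilbertian_norm {R d} c D N.

Section operators.
Context (R : realType) (n : nat) (e : 'I_n -> nat).
Implicit Types (Ds : forall i, set 'rV[R]_(e i)).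
Implicit Types (f g : forall i, 'rV[R]_(e i) -> R).

(** $\mathbb{L}(D) = L^2(D_1)\times\dots\times L^2(D_n)$ *)
Definition L2prod Ds f :=
  forall i, L2 (Ds i) (f i).

Definition L2prod_norm Ds f : R :=
  Num.sqrt (\sum_i L2norm (Ds i) (f i) ^+ 2).

Definition L2prod_eq Ds f g :=
  forall i, f i = g i %[ae lebesgue_rV R (e i) in Ds i].

(** A linear operator from a space [V] of functions to [L2prod]. For a bounded
    one, the class of the image depends only on that of the argument. *)
Definition linear_operator Ds X m (V : set (X -> 'rV[R]_m))
    (L : (X -> 'rV[R]_m) -> forall i, 'rV[R]_(e i) -> R) :=
  (forall v, V v -> L2prod Ds (L v)) /\
  forall a v w, V v -> V w ->
    L2prod_eq Ds (L (fun x => a *: v x + w x))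
                 (fun i y => a * L v i y + L w i y).

End operators.

Section neural_networks.
Context (R : realType).

(** Neural networks with input dimension [p] and output dimension [q], layer by
    layer; the last layer has the identity as activation. *)
Inductive network (p q : nat) : Type :=
| Output of 'M[R]_(q, p) & 'rV[R]_q
| Hidden k of 'M[R]_(k, p) & 'rV[R]_k & ('I_k -> R -> R) & network k q.

Fixpoint depth p q (Phi : network p q) : nat :=
  match Phi with
  | Output _ _ => 1
  | Hidden _ _ _ _ Psi => (depth Psi).+1
  end.

Fixpoint realization p q (Phi : network p q) : 'rV[R]_p -> 'rV[R]_q :=
  match Phi with
  | Output A b => fun x => x *m A^T + b
  | Hidden _ A b rho Psi => fun x =>
      realization Psi (\row_j rho j ((x *m A^T + b) 0 j))
  end.

Definition relu (x : R) : R := Num.max 0 x.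

Definition bisu (x : R) : R := if 0 < x then 1 else 0.

Fixpoint relu_bisu p q (Phi : network p q) : Prop :=
  match Phi with
  | Output _ _ => True
  | Hidden _ _ _ rho Psi =>
      (forall j, rho j = relu \/ rho j = bisu) /\ relu_bisu Psi
  end.

(** [Phi] selects the network $\Phi^{\mathbb{W},v}$ of each $v\in\mathbb{W}$
    (a function of the a.e. class of [v]). *)
Definition fosls_networks d m (D : set 'rV[R]_d)
    (W : set ('rV[R]_d -> 'rV[R]_m))
    (Phi : ('rV[R]_d -> 'rV[R]_m) -> network d m) :=
  (forall v, W v -> [/\ depth (Phi v) = 5%N, relu_bisu (Phi v)
     & realization (Phi v) = v %[ae lebesgue_rV R d in D]]) /\
  forall v w, W v -> W w -> v = w %[ae lebesgue_rV R d in D] -> Phi v = Phi w.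

End neural_networks.

Definition is_min (R : realType) (A : set R) (m : R) := A m /\ lbound A m.

(* Main.v *)
Require Import Defs.
From HB Require Import structures.
From mathcomp Require Import all_boot all_order all_algebra.
From mathcomp Require Import all_classical all_reals all_analysis.
From mathcomp Require Import measurable_realfun ring lra.
Set Implicit Arguments.
Unset Strict Implicit.
Unset Printing Implicit Defensive.
Import Order.TTheory GRing.Theory Num.Theory.
Import numFieldNormedType.Exports.
Local Open Scope classical_set_scope.
Local Open Scope ring_scope.

(** Up to a.e. equality the finite element space [W] is finite-dimensional. The
    error and the residual [||F - L v|| = ||L (U - v)||] of [v] are the values at
    [U - v] of seminorms on the Sobolev space [V] induced by semi-inner products
    (the given one, and the pullback by [L] of that of [L2prod]) that vanish
    exactly on null functions. Orthogonal projection of [U] onto [W] yields the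
    minimizers, and uniqueness up to null functions. Realizations of ReLU/BiSU
    networks are measurable, hence, being a.e. equal to elements of [W], they
    belong to [V], where null functions change neither seminorm. *)

(** * Projection onto finite-dimensional subspaces *)

(** Functions are not quotiented by a.e. equality, and this shapes the proof. The forms at hand are
    only semi-definite, so projection has to be carried out in the presence of vectors of square 0.
    Moreover the sigma-algebra is the Borel one, without completion: a function that is a.e. equal
    to an element of [V] can fail to be measurable, hence can lie outside [V]. This is why the
    measurability of realizations matters. No basis or degrees of freedom of the finite element
    spaces are constructed. It suffices that the elements are a.e. affine on each simplex, so that
    finitely many coefficients determine them up to null functions; this bounds the length of
    orthonormal families. Best approximation is stated as a Pythagorean identity: its extra square
    gives minimality by its sign, and uniqueness when it vanishes. Uniqueness of the network, not
    just of its class, then comes from [cL > 0] and from [Phi] being constant on classes. *)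

Section projection.
Context (R : rcfType) (E : lmodType R).
Implicit Types (V W : set E) (u v w x y : E) (ip : E -> E -> R).

Definition linear_subspace V :=
  V 0 /\ forall a u v, V u -> V v -> V (a *: u + v).

Definition semi_inner V ip :=
  [/\ forall v w, V v -> V w -> ip v w = ip w v,
      forall a u v w, V u -> V v -> V w ->
        ip (a *: u + v) w = a * ip u w + ip v w
    & forall v, V v -> 0 <= ip v v].

Lemma subspaceZ V a u : linear_subspace V -> V u -> V (a *: u).
Proof. by move=> [V0 VL] Vu; rewrite -[_ *: _]addr0; exact: VL. Qed.

Lemma subspaceD V u v : linear_subspace V -> V u -> V v -> V (u + v).
Proof. by move=> [_ VL] Vu Vv; rewrite -[u]scale1r; exact: VL. Qed.

Lemma subspaceB V u v : linear_subspace V -> V u -> V v -> V (u - v).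
Proof. by move=> [_ VL] Vu Vv; rewrite addrC -scaleN1r; exact: VL. Qed.

Lemma subspace_sum V k (a : 'I_k -> R) (s : 'I_k -> E) :
  linear_subspace V -> (forall i, V (s i)) -> V (\sum_i a i *: s i).
Proof.
move=> sV Vs; apply: (big_ind V); first exact: sV.1.
  by move=> u v; exact: subspaceD.
by move=> i _; exact: subspaceZ.
Qed.

Section semi_inner_theory.
Variables (V : set E) (ip : E -> E -> R).
Hypotheses (sV : linear_subspace V) (ipV : semi_inner V ip).

Lemma ipC u v : V u -> V v -> ip u v = ip v u.
Proof. by case: ipV => + _ _; exact. Qed.

Lemma ipLl a u v w : V u -> V v -> V w ->
  ip (a *: u + v) w = a * ip u w + ip v w.
Proof. by case: ipV => _ + _; exact. Qed.

Lemma ip_ge0 v : V v -> 0 <= ip v v.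
Proof. by case: ipV => _ _; exact. Qed.

Lemma ip0l w : V w -> ip 0 w = 0.
Proof.
move=> Vw; have := ipLl 1 sV.1 sV.1 Vw.
by rewrite scaler0 addr0 mul1r => /eqP; rewrite -subr_eq0 opprD addNKr oppr_eq0 => /eqP.
Qed.

Lemma ipZl a u w : V u -> V w -> ip (a *: u) w = a * ip u w.
Proof. by move=> Vu Vw; have := ipLl a Vu sV.1 Vw; rewrite addr0 ip0l// addr0. Qed.

Lemma ipDl u v w : V u -> V v -> V w -> ip (u + v) w = ip u w + ip v w.
Proof. by move=> Vu Vv Vw; have := ipLl 1 Vu Vv Vw; rewrite scale1r mul1r. Qed.

Lemma ipBl u v w : V u -> V v -> V w -> ip (u - v) w = ip u w - ip v w.
Proof.
by move=> Vu Vv Vw; have := ipLl (-1) Vv Vu Vw; rewrite scaleN1r mulN1r !(addrC (- _)).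
Qed.

Lemma ip_suml k (a : 'I_k -> R) (s : 'I_k -> E) w :
  (forall i, V (s i)) -> V w ->
  ip (\sum_i a i *: s i) w = \sum_i a i * ip (s i) w.
Proof.
move=> Vs Vw.
suff [] : V (\sum_i a i *: s i) /\
  ip (\sum_i a i *: s i) w = \sum_i a i * ip (s i) w by [].
elim/big_rec2 : _ => [|i y x _ [Vx ih]]; first by split; [exact: sV.1|exact: ip0l].
by split; [exact: sV.2|rewrite ipLl// ih].
Qed.

Lemma ip_sqD u v : V u -> V v ->
  ip (u + v) (u + v) = ip u u + ip u v *+ 2 + ip v v.
Proof.
move=> Vu Vv; have Vuv := subspaceD sV Vu Vv.
rewrite ipDl// (ipC Vu Vuv) (ipC Vv Vuv) !ipDl// (ipC Vv Vu); ring.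
Qed.

(** The case of the Cauchy-Schwarz inequality in which one vector has square 0; it makes such
    vectors invisible to the form. *)
Lemma ip_eq0 u v : V u -> V v -> ip v v = 0 -> ip u v = 0.
Proof.
move=> Vu Vv v0; apply/eqP; apply: contraT => uv0.
(* Since [ip v v = 0], the square of [u + a *: v] is affine in [a]; this [a] makes it equal to -1,
   against positivity. *)
pose a := - (ip u u + 1) / (ip u v *+ 2).
have := ip_ge0 (subspaceD sV Vu (subspaceZ a sV Vv)).
rewrite ip_sqD//; last exact: subspaceZ.
have Vav := subspaceZ a sV Vv.
rewrite (ipC Vu)// !ipZl// (ipC Vv Vav) ipZl// v0 !mulr0 addr0 (ipC Vv)//.
rewrite -mulrnAr /a divfK ?mulrn_eq0//.
by rewrite opprD addrA subrr sub0r oppr_ge0 ler10.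
Qed.

Lemma ip_sqD_null u v : V u -> V v -> ip v v = 0 -> ip (u + v) (u + v) = ip u u.
Proof. by move=> Vu Vv v0; rewrite ip_sqD// (ip_eq0 Vu Vv v0) v0 mul0rn !addr0. Qed.

Section finite_dimension.
(** [rep v p] says that [p] is a coefficient vector of [v]. It is a linear relation and not a map
    because coefficients are chosen up to a.e. equality and [E] has no quotient; [rep_null] replaces
    injectivity. *)
Variables (W : set E) (P : vectType R) (rep : E -> P -> Prop).
Hypotheses (WV : W `<=` V) (sW : linear_subspace W).
Hypotheses
  (rep_total : forall v, W v -> exists p, rep v p)
  (rep_lin : forall a u v p q, W u -> W v -> rep u p -> rep v q ->
     rep (a *: u + v) (a *: p + q))
  (rep_null : forall v, W v -> rep v 0 -> ip v v = 0).

Let orthonormal k (s : 'I_k -> E) :=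
  (forall i, W (s i)) /\ forall i j, ip (s i) (s j) = (i == j)%:R.

(** Coefficient vectors of an orthonormal family are free: if a combination of them is 0, the same
    combination of the [s i] has square 0, and that square is the sum of the squared scalars. *)
Let orthonormal_dim k (s : 'I_k -> E) : orthonormal s -> (k <= \dim {:P})%N.
Proof.
move=> [Ws os]; have Vs i := WV (Ws i).
have /choice[p ps] : forall i, exists p, rep (s i) p by move=> i; exact: rep_total.
have rep_sum (a : 'I_k -> R) : rep (\sum_i a i *: s i) (\sum_i a i *: p i).
  suff [] : W (\sum_i a i *: s i) /\ rep (\sum_i a i *: s i) (\sum_i a i *: p i) by [].
  elim/big_rec2 : _ => [|i y x _ [Wx ih]]; last by split; [exact: sW.2|exact: rep_lin].
  split; first exact: sW.1.
  (* The vector 0 has some coefficients [q], and linearity of [rep] turns them into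
     [- q + q = 0]. *)
  have [q q0] := rep_total sW.1.
  by have := rep_lin (-1) sW.1 sW.1 q0 q0; rewrite scaler0 addr0 scaleN1r addNr.
pose X := [tuple p i | i < k].
suff /eqP : free X by rewrite size_tuple => <-; exact/dimvS/subvf.
apply/freeP => a aX i.
have Wsa : W (\sum_j a j *: s j) by exact: subspace_sum.
have := rep_sum a.
rewrite [X in rep _ X](_ : _ = 0); last first.
  by rewrite -[RHS]aX; apply: eq_bigr => j _; rewrite -tnth_nth tnth_mktuple.
move=> /(rep_null Wsa); rewrite ip_suml//; last exact: WV.
under eq_bigr => j _.
  rewrite (ipC (Vs j) (WV Wsa)) ip_suml//.
  under eq_bigr do rewrite os.
  rewrite (bigD1 j)//= eqxx mulr1 big1 ?addr0; last first.
    by move=> l /negPf ->; rewrite mulr0.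
  over.
move/eqP; rewrite psumr_eq0 => [|j _]; last by rewrite -expr2 sqr_ge0.
by move=> /allP/(_ i); rewrite mem_index_enum mulf_eq0 orbb => /(_ isT)/eqP.
Qed.

(** An orthonormal family in [W] of maximal length exists because lengths are bounded. The Fourier
    sum over it is the projection: [u - pr u] is orthogonal to the family, and the family misses
    only vectors of square 0 in [W]. *)
Lemma orthogonal_projection u : V u ->
  exists2 w, W w & forall v, W v -> ip (u - w) v = 0.
Proof.
move=> Vu.
pose Q k := `[< exists s : 'I_k -> E, orthonormal s >].
have Q0 : exists k, Q k.
  exists 0%N; apply/asboolP; exists (fun=> 0).
  by split=> [|i j]; [move=> _; exact: sW.1|case: (notF (valP i))].
have Qle k : Q k -> (k <= \dim {:P})%N by move=> /asboolP[s]; exact: orthonormal_dim.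
have [k /asboolP[s [Ws os]] kmax] := ex_maxnP Q0 Qle.
have Vs i := WV (Ws i).
pose pr v := \sum_i ip v (s i) *: s i.
have Wpr v : W (pr v) by exact: subspace_sum.
have pr_s v i : V v -> ip (v - pr v) (s i) = 0.
  move=> Vv; rewrite ipBl//; last exact: WV.
  rewrite ip_suml// (bigD1 i)//= os eqxx mulr1 big1 ?addr0 ?subrr// => j /negPf ji.
  by rewrite os ji mulr0.
(* Otherwise the normalized remainder [n] would extend the family to length [k.+1], against
   maximality. *)
have pr0 v : W v -> ip (v - pr v) (v - pr v) = 0.
  move=> Wv; set r := v - pr v; have Wr : W r by exact: subspaceB.
  have Vr := WV Wr.
  apply/eqP; apply: contraT => r0.
  have {}r0 : 0 < ip r r by rewrite lt_def r0 ip_ge0.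
  have sr0 : Num.sqrt (ip r r) != 0 by rewrite gt_eqF// sqrtr_gt0.
  pose n := (Num.sqrt (ip r r))^-1 *: r.
  have Wn : W n by exact: subspaceZ.
  have Vn := WV Wn.
  pose t (i : 'I_k.+1) := if unlift ord_max i is Some j then s j else n.
  suff /asboolP/kmax : exists t : 'I_k.+1 -> E, orthonormal t by rewrite ltnn.
  exists t; split=> [i|i j]; first by rewrite /t; case: unliftP.
  have ns l : ip n (s l) = 0 by rewrite ipZl// pr_s ?mulr0//; exact: WV.
  rewrite /t; case: (unliftP ord_max i) => [i' ->|->];
      case: (unliftP ord_max j) => [j' ->|->].
  - by rewrite os (inj_eq lift_inj).
  - by rewrite (ipC (Vs _) Vn) ns eq_sym (negPf (neq_lift _ _)).
  - by rewrite ns (negPf (neq_lift _ _)).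
  - rewrite eqxx ipZl// (ipC Vr Vn) ipZl// mulrA -expr2 exprVn sqr_sqrtr ?ltW//.
    by rewrite mulVf// gt_eqF.
exists (pr u) => // v Wv.
have Vv := WV Wv; have Vup : V (u - pr u) by apply: subspaceB => //; exact: WV.
(* Of the two summands of [v], the first has square 0 and is orthogonal to everything, the second is
   a combination of the [s i]. *)
rewrite -[v in ip _ v](subrK (pr v)).
have Vp : V (pr v) := WV (Wpr v).
have Vvp : V (v - pr v) by exact: subspaceB.
rewrite (ipC Vup (subspaceD sV Vvp Vp)) ipDl// ip_suml// big1 ?addr0 => [|i _].
  by rewrite (ipC Vvp Vup) ip_eq0 // pr0.
by rewrite (ipC (Vs _) Vup) pr_s// mulr0.
Qed.

Lemma best_approximation u : V u ->
  exists2 w, W w & forall v, W v ->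
    ip (u - v) (u - v) = ip (u - w) (u - w) + ip (w - v) (w - v).
Proof.
move=> Vu; have [w Ww uw] := orthogonal_projection Vu.
exists w => // v Wv.
have Wwv : W (w - v) by exact: subspaceB.
have Vuw : V (u - w) by apply: subspaceB => //; exact: WV.
by rewrite -[u - v](subrKA w) (ip_sqD Vuw (WV Wwv)) (uw _ Wwv) mul0rn addr0.
Qed.

End finite_dimension.
End semi_inner_theory.
End projection.

(** * Lebesgue measure and L2 spaces *)

Section measurability_rV.
Context (R : realType).

Lemma measurable_box n (I : 'I_n -> interval R) :
  measurable [set x : 'rV[R]_n | forall i, x 0 i \in I i].
Proof.
rewrite [X in measurable X](_ : _ = \bigcap_(i in setT)
    ((fun x : 'rV[R]_n => x 0 i) @^-1` [set` I i])).
  apply: fin_bigcap_measurable => // i _.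
  rewrite -[X in measurable X]setTI.
  by apply: measurable_coord => //; exact: measurable_itv.
by apply/seteqP; split=> x /= xA i => [_|]; exact: xA.
Qed.

(** The sigma-algebra is generated by coordinates, so open sets must be exhausted by countably many
    boxes: those with rational centre and radius [k.+1%:R^-1] that are contained in [A]. *)
Lemma open_measurable_rV n (A : set 'rV[R]_n) : open A -> measurable A.
Proof.
move=> oA.
pose B (q : 'rV[rat]_n * nat) : set 'rV[R]_n :=
  [set x | forall i, x 0 i \in `](ratr (q.1 0 i) - q.2.+1%:R^-1),
                                 (ratr (q.1 0 i) + q.2.+1%:R^-1)[].
have mB q : measurable (B q) by exact: measurable_box.
have BP q x : B q x <-> forall i, `|x 0 i - ratr (q.1 0 i)| < q.2.+1%:R^-1.
  by split=> Bx i; have := Bx i; rewrite in_itv /= ltr_distl.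
rewrite [A](_ : _ = \bigcup_q (if `[< B q `<=` A >] then B q else set0)).
  apply: countable_bigcupT_measurable => [|q]; first exact: countableP.
  by case: ifP.
apply/seteqP; split=> [x Ax|x [q _]]; last first.
  by case: ifPn => // /asboolP; exact.
have /nbhs_ballP[e /= e0 xeA] : nbhs x A by exact: open_nbhs_nbhs.
(* Two radii must fit into [e]: one from [x] to the rational centre, one from there to a point of
   the box. *)
pose k := Num.trunc (2 / e).
have k0 : 0 < k.+1%:R^-1 :> R by rewrite invr_gt0.
have ke : k.+1%:R^-1 + k.+1%:R^-1 < e.
  by rewrite -mulr2n -[_ *+ 2]mulr_natl ltr_pdivrMr// mulrC -ltr_pdivrMr// truncnS_gt.
have /choice[q xq] : forall i, exists q : rat, `|x 0 i - ratr q| < k.+1%:R^-1.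
  move=> i; have /rat_in_itvoo[q] : x 0 i - k.+1%:R^-1 < x 0 i + k.+1%:R^-1.
    by rewrite ltrBlDr -addrA ltrDl addr_gt0.
  by rewrite in_itv /= => xqx; exists q; rewrite distrC ltr_distl.
exists (\row_i q i, k) => //.
have -> : `[< B (\row_i q i, k) `<=` A >].
  apply/asboolP => y /BP By; apply: xeA; split=> // i j.
  rewrite (ord1 i) -ball_normE /=.
  rewrite (le_lt_trans (ler_distD (ratr (q j)) _ _))// (lt_trans _ ke)// ltrD//.
  by have := By j; rewrite mxE distrC.
by apply/BP => i; rewrite mxE.
Qed.

Lemma continuous_measurable_rV n (f : 'rV[R]_n -> R) :
  continuous f -> measurable_fun setT (f : _ -> measurableTypeR R).
Proof.
move=> /continuousP cf; apply: (measurability _ (RGenOpens.measurableE R)).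
move=> _ [_ [a [b ->] <-]]; rewrite setTI; apply: open_measurable_rV.
exact/cf/interval_open.
Qed.

Lemma rV_cons0 n (a : R) (y : 'rV[R]_n) : rV_cons (a, y) 0 0 = a.
Proof.
have -> : 0 = lshift n (ord0 : 'I_1) by apply/val_inj.
by apply: etrans (row_mxEl _ _ _ _) _; rewrite mxE eqxx mulr1n.
Qed.

Lemma rV_consS n (a : R) (y : 'rV[R]_n) i : rV_cons (a, y) 0 (lift ord0 i) = y 0 i.
Proof.
have -> : lift ord0 i = rshift 1 i by apply/val_inj.
exact: row_mxEr.
Qed.

Definition cube n (M : R) := [set x : 'rV[R]_n | forall i, x 0 i \in `[- M, M]].

Lemma lebesgue_rV_cube_lty n (M : R) : (lebesgue_rV R n (@cube n M) < +oo)%E.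
Proof.
elim: n => [|n ih]; first by rewrite /= diracE ltry.
rewrite [X in (X < _)%E](_ : _ =
    (lebesgue_measure `[(- M)%R, M] * lebesgue_rV R n (@cube n M))%E).
  rewrite lte_mul_pinfty// ge0_fin_numE// lebesgue_measure_itv.
  by case: ifP => _; rewrite ltry.
rewrite -product_measure1E//=; last exact: measurable_box.
rewrite /lebesgue_rV_succ /pushforward; congr (product_measure1 _ _ _).
apply/seteqP; split=> -[a y] /=.
  move=> ya; split; first by have := ya 0; rewrite rV_cons0.
  by move=> i; have := ya (lift ord0 i); rewrite rV_consS.
move=> [aM yM] i; case: (unliftP ord0 i) => [j|] ->; last by rewrite rV_cons0.
by rewrite rV_consS; exact: yM.
Qed.

Lemma bounded_lebesgue_rV_lty n (D : set 'rV[R]_n) :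
  measurable D -> bounded_set D -> (lebesgue_rV R n D < +oo)%E.
Proof.
move=> mD [M [_ DM]].
(* [bounded_set] provides a bound only for numbers strictly above [M], hence [M + 1]. *)
apply: le_lt_trans (lebesgue_rV_cube_lty n (M + 1)).
rewrite le_measure ?inE//; first exact: measurable_box.
move=> x Dx i; rewrite in_itv /= -ler_norml.
apply: le_trans (DM (M + 1) _ _ Dx); last by rewrite ltrDl.
rewrite [leRHS]/Num.norm /= mx_normrE.
exact: (@le_bigmax _ _ _ 0 (fun ij => `|x ij.1 ij.2|) (0, i)).
Qed.
End measurability_rV.

(** * Square-integrable functions and their norm on a measurable set *)

Section L2_theory.
Context (R : realType) (d : nat) (D : set 'rV[R]_d).
Hypothesis mD : measurable D.
Implicit Types u v w : 'rV[R]_d -> R.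
Local Notation mu := (lebesgue_rV R d).

Lemma L2_measurable u : L2 D u -> measurable_fun D u.
Proof.
rewrite /L2 inE => /andP[]; rewrite inE => mf _.
exact/(measurable_restrictT _ mD).
Qed.

Lemma L2_lin a u v : L2 D u -> L2 D v -> L2 D (fun x => a * u x + v x).
Proof.
rewrite /L2 => Lu Lv.
rewrite (_ : _ \_ D = a *: (u \_ D) + v \_ D).
  by apply: (Lfun_submod_closed _ (lee1n 2)).2.
apply/funext => x; rewrite -[RHS]/(a * (u \_ D) x + (v \_ D) x) !patchE.
by case: ifP => // _; rewrite -[point]/(0 : R) mulr0 addr0.
Qed.

Lemma L2_integrableM u v : L2 D u -> L2 D v ->
  mu.-integrable D (EFin \o (fun x => u x * v x)).
Proof.
move=> Lu Lv; apply/(integrable_mkcond _ mD); rewrite restrict_EFin.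
have /Lfun1_integrable := Lfun2_mul_Lfun1 Lu Lv.
congr (mu.-integrable _ _); apply/funext => x /=; congr EFin.
by rewrite !patchE; case: ifP => // _; rewrite mulr0.
Qed.

Lemma L2norm_sqr u : L2 D u ->
  L2norm D u ^+ 2 = \int[mu]_(x in D) (u x * u x).
Proof.
move=> Lu; rewrite Rintegral_mkcond /L2norm.
have Ny : ('N[mu]_2%:E[EFin \o (u \_ D)] < +oo)%E.
  by move: Lu; rewrite /L2 inE => /andP[_]; rewrite inE.
have Nf : ('N[mu]_2%:E[EFin \o (u \_ D)])%E \is a fin_num.
  by rewrite ge0_fin_numE// Lnorm_ge0.
rewrite -[LHS]/(fine (_ ^+ 2)%:E) -powR_mulrn; last by rewrite fine_ge0// Lnorm_ge0.
rewrite -poweR_EFin fineK// poweR_Lnorm//; congr fine.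
apply: eq_integral => x _ /=; rewrite powR_mulrn// !patchE.
by case: ifP => _; rewrite ?normr0 ?expr0n// real_normK ?num_real.
Qed.

Lemma L2P u : measurable_fun D u ->
  mu.-integrable D (EFin \o (fun x => u x * u x)) -> L2 D u.
Proof.
move=> mu_ /integrableP[_ iu]; rewrite /L2 inE; apply/andP; split; rewrite inE/=.
  exact/(measurable_restrictT _ mD).
rewrite /finite_norm unlock poweR_lty//; apply: le_lt_trans iu.
rewrite [leRHS]integral_mkcond le_eqVlt; apply/orP; left; apply/eqP.
apply: eq_integral => x _ /=.
rewrite powR_mulrn// !patchE; case: ifP => _; rewrite ?normr0 ?expr0n//=.
by rewrite normrM.
Qed.

Lemma RintegralL a u v : mu.-integrable D (EFin \o u) ->
  mu.-integrable D (EFin \o v) ->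
  \int[mu]_(x in D) (a * u x + v x) =
  a * \int[mu]_(x in D) u x + \int[mu]_(x in D) v x.
Proof.
move=> iu iv; rewrite RintegralD// ?RintegralZl//.
exact: (integrableZl mD a iu).
Qed.

Lemma ae_eq_Rintegral u v : measurable_fun D u -> measurable_fun D v ->
  u = v %[ae mu in D] -> \int[mu]_(x in D) u x = \int[mu]_(x in D) v x.
Proof.
move=> mu_ mv uv; congr fine; apply: ae_eq_integral => //.
- exact/measurable_EFinP.
- exact/measurable_EFinP.
- by apply: filterS uv => x /[apply] /= ->.
Qed.

Lemma ae0_Rintegral u : measurable_fun D u -> u = (fun=> 0) %[ae mu in D] ->
  \int[mu]_(x in D) u x = 0.
Proof.
move=> mu_ u0; rewrite (ae_eq_Rintegral _ _ u0)//.
by rewrite Rintegral_cst// mul0r.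
Qed.

Lemma L2_ae0 u : measurable_fun D u -> u = (fun=> 0) %[ae mu in D] -> L2 D u.
Proof.
move=> mu_ u0; apply: L2P => //; apply/integrableP; split.
  exact/measurable_EFinP/measurable_funM.
rewrite (ae_eq_integral (cst 0%E)) ?integral0//.
  apply: measurableT_comp => //; exact/measurable_EFinP/measurable_funM.
by apply: filterS u0 => x /= /[apply] ->; rewrite mulr0 normr0.
Qed.

Lemma L2norm_ge0 u : 0 <= L2norm D u.
Proof. by rewrite /L2norm fine_ge0// Lnorm_ge0. Qed.

Lemma ae0_L2norm u : measurable_fun D u -> u = (fun=> 0) %[ae mu in D] ->
  L2norm D u = 0.
Proof.
move=> mu_ u0; apply/eqP; rewrite -sqrf_eq0 L2norm_sqr; last exact: L2_ae0.
apply/eqP/ae0_Rintegral; first exact: measurable_funM.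
by apply: filterS u0 => x /[apply] ->; rewrite mulr0.
Qed.

Lemma ae_eq_L2norm u v : L2 D u -> L2 D v -> u = v %[ae mu in D] ->
  L2norm D u = L2norm D v.
Proof.
move=> Lu Lv uv; apply: (@pexpIrn _ 2) => //; rewrite ?nnegrE ?L2norm_ge0//.
have mu_ := L2_measurable Lu; have mv := L2_measurable Lv.
rewrite !L2norm_sqr//; apply: ae_eq_Rintegral; [exact: measurable_funM..|].
by apply: filterS uv => x /[apply] ->.
Qed.

(** Pointwise, the right-hand side exceeds the left-hand one by [(a * u x - v x) ^+ 2]. The squared
    form fits the sum of squares in [H10]. *)
Lemma L2norm_lin_le a u v : L2 D u -> L2 D v ->
  L2norm D (fun x => a * u x + v x) ^+ 2 <=
  2 * (a ^+ 2 * L2norm D u ^+ 2 + L2norm D v ^+ 2).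
Proof.
move=> Lu Lv; have Lw := L2_lin a Lu Lv.
have iu := L2_integrableM Lu Lu; have iv := L2_integrableM Lv Lv.
rewrite !L2norm_sqr// -RintegralL// -RintegralZl//; last first.
  by have := integrableD mD (integrableZl mD (a ^+ 2) iu) iv.
apply: le_Rintegral => //; first exact: L2_integrableM.
  have := integrableD mD (integrableZl mD (a ^+ 2) iu) iv.
  exact: (integrableZl mD 2).
move=> x _ /=; rewrite -subr_ge0.
rewrite [X in 0 <= X](_ : _ = (a * u x - v x) ^+ 2) ?sqr_ge0//; ring.
Qed.

Lemma bounded_continuous_L2 u : bounded_set D -> continuous u -> L2 D u.
Proof.
move=> bD cu.
have mu_ : measurable_fun D u.
  by apply: measurable_funTS; exact: continuous_measurable_rV.
apply: L2P => //.
have i1 : mu.-integrable D (EFin \o (fun=> 1)).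
  apply/integrableP; split; first exact: measurable_cst.
  rewrite [X in (X < _)%E](_ : _ = (\int[mu]_(x in D) 1)%E).
    by rewrite integral_cst// mul1e bounded_lebesgue_rV_lty.
  by apply: eq_integral => x _ /=; rewrite normr1.
have [M [Mr DM]] := bD.
pose K := closed_ball_ (@Num.norm R 'rV[R]_d) 0 (M + 1).
have cK : compact K.
  apply: bounded_closed_compact; last exact: closed_closed_ball_.
  exists (M + 1); split; first exact: num_real.
  move=> y My x; rewrite /K /closed_ball_ /= sub0r normrN => /le_trans -> //.
  exact: ltW.
have DK : D `<=` K.
  move=> x Dx; rewrite /K /closed_ball_ /= sub0r normrN.
  by apply: (DM (M + 1) _ _ Dx); rewrite ltrDl.
have [N [Nr KN]] : bounded_set (u @` K).
  apply: compact_bounded; apply: continuous_compact => //.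
  exact: continuous_subspaceT.
(* A bounded factor times the constant 1, which is integrable because [D] has finite measure;
   boundedness comes from a compact ball around [D]. *)
rewrite (_ : EFin \o _ = ((EFin \o (u \* u)%R) \* (EFin \o (fun=> 1%R)))%E); last first.
  by apply/funext => x /=; rewrite mule1.
apply: integrableMr => //; first exact: measurable_funM.
exists ((N + 1) ^+ 2); split; first exact: num_real.
move=> y Ny x Dx /=; apply: le_trans (ltW Ny); rewrite normrM -expr2.
have uN : `|u x| <= N + 1.
  by apply: (KN (N + 1)); [rewrite ltrDl|exists x => //; exact: DK].
by rewrite lerXn2r ?nnegrE// (le_trans _ uN).
Qed.

End L2_theory.

(** * Sobolev and finite element spaces *)

Section test_functions.
Context (R : realType) (d : nat).
Implicit Types (D : set 'rV[R]_d) (f g phi psi : 'rV[R]_d -> R).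

Lemma partial_lin i a f g : (forall x, differentiable f x) ->
  (forall x, differentiable g x) ->
  partial i (fun x => a * f x + g x) = fun x => a * partial i f x + partial i g x.
Proof.
move=> df dg; apply/funext => x; rewrite /partial.
have dfx : derivable f x (delta_mx 0 i) by exact: diff_derivable.
have dgx : derivable g x (delta_mx 0 i) by exact: diff_derivable.
rewrite -[a * _](deriveZ a dfx) -deriveD//.
exact: derivableZ.
Qed.

Lemma iterated_partial_lin a f g s : smooth f -> smooth g ->
  foldr (@partial R d) (fun x => a * f x + g x) s =
  fun x => a * foldr (@partial R d) f s x + foldr (@partial R d) g s x.
Proof. by move=> sf sg; elim: s => //= i s ->; rewrite partial_lin. Qed.

Lemma smooth_lin a f g : smooth f -> smooth g -> smooth (fun x => a * f x + g x).
Proof.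
move=> sf sg s x; rewrite iterated_partial_lin//.
apply: differentiableD => //.
exact: (differentiableZ a (sf s x)).
Qed.

Lemma smooth0 : smooth (fun _ : 'rV[R]_d => 0 : R).
Proof.
move=> s; rewrite (_ : foldr _ _ _ = fun=> 0) => [x|]; first exact: differentiable_cst.
elim: s => //= i s ->; apply/funext => x; exact: derive_cst.
Qed.

Lemma smooth_continuous f : smooth f -> continuous f.
Proof. by move=> sf x; apply: differentiable_continuous; exact: (sf [::]). Qed.

Lemma smooth_partial_continuous i f : smooth f -> continuous (partial i f).
Proof. by move=> sf x; apply: differentiable_continuous; exact: (sf [:: i]). Qed.

Lemma test_function_lin D a phi psi : test_function D phi ->
  test_function D psi -> test_function D (fun x => a * phi x + psi x).
Proof.
move=> [sphi [K [cK KD K0]]] [spsi [K' [cK' K'D K'0]]].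
split; first exact: smooth_lin.
exists (K `|` K'); split; first exact: compactU.
- by rewrite subUset.
- by move=> x /not_orP[Kx K'x]; rewrite K0// K'0// mulr0 addr0.
Qed.

Lemma test_function0 D : test_function D (fun=> 0).
Proof. by split; [exact: smooth0|exists set0; split=> //; exact: compact0]. Qed.

End test_functions.

(** * Linear combinations and null functions in the Sobolev spaces *)

Section weak_derivatives.
Context (R : realType) (d : nat) (D : set 'rV[R]_d).
Hypotheses (oD : open D) (bD : bounded_set D).
Implicit Types (u w g h phi : 'rV[R]_d -> R) (v : 'rV[R]_d -> 'rV[R]_d).
Local Notation mu := (lebesgue_rV R d).
Local Notation L2field v := (forall i, L2 D (fun x => v x 0 i)).

Let mD : measurable D. Proof. exact: open_measurable_rV. Qed.

Lemma smooth_L2 phi : smooth phi -> L2 D phi.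
Proof. by move=> /smooth_continuous; exact: bounded_continuous_L2. Qed.

Lemma smooth_partial_L2 i phi : smooth phi -> L2 D (partial i phi).
Proof. by move=> /smooth_partial_continuous-/(_ i); exact: bounded_continuous_L2. Qed.

(** [I], [J] and [H] stand for the left-hand integrands of the integration by parts formula, which
    makes this the common core of the gradient, divergence and curl cases. *)
Lemma green_lin a (I J H : 'rV[R]_d -> R) g h phi :
  L2 D g -> L2 D h -> smooth phi ->
  mu.-integrable D (EFin \o I) -> mu.-integrable D (EFin \o J) ->
  (forall x, H x = a * I x + J x) ->
  \int[mu]_(x in D) I x = - (\int[mu]_(x in D) (g x * phi x)) ->
  \int[mu]_(x in D) J x = - (\int[mu]_(x in D) (h x * phi x)) ->
  \int[mu]_(x in D) H x = - (\int[mu]_(x in D) ((a * g x + h x) * phi x)).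
Proof.
move=> Lg Lh /smooth_L2 Lphi iI iJ HIJ eI eJ.
under eq_Rintegral do rewrite HIJ.
rewrite RintegralL// eI eJ.
under [in RHS]eq_Rintegral do rewrite mulrDl -mulrA.
rewrite (RintegralL mD a (L2_integrableM mD Lg Lphi) (L2_integrableM mD Lh Lphi)).
by rewrite mulrN opprD.
Qed.

Lemma green_ae0 (H : 'rV[R]_d -> R) phi :
  measurable_fun D H -> H = (fun=> 0) %[ae mu in D] ->
  \int[mu]_(x in D) H x = - (\int[mu]_(x in D) (0 * phi x)).
Proof.
move=> mH H0; rewrite (ae0_Rintegral mD mH H0).
under eq_Rintegral do rewrite mul0r.
by rewrite Rintegral_cst// mul0r oppr0.
Qed.

Lemma L2_cst0 : L2 D (fun=> 0).
Proof. by apply: L2_ae0 => //; exact: aeW. Qed.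

Lemma H10_lin a u w : H10 D u -> H10 D w -> H10 D (fun x => a * u x + w x).
Proof.
move=> [Lu [g [[Lg wg] ag]]] [Lw [h [[Lh wh] ah]]].
split; first exact: L2_lin.
exists (fun i x => a * g i x + h i x); split.
  split=> [i|i phi tphi]; first exact: L2_lin.
  have sphi := tphi.1; have Lp := smooth_partial_L2 i sphi.
  apply: (green_lin (I := fun x => u x * partial i phi x)
                    (J := fun x => w x * partial i phi x)) => //.
  - exact: L2_integrableM.
  - exact: L2_integrableM.
  - by move=> x; rewrite mulrDl mulrA.
  - exact: wg.
  - exact: wh.
move=> eps eps0.
(* The error will be at most [2 * (a ^+ 2 * A + B)]; with [A < eps / (4 * (a ^+ 2 + 1))] and
   [B < eps / 4], each half stays below [eps / 2]. The added 1 keeps the divisor positive when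
   [a = 0]. *)
have a0 : 0 < 4 * (a ^+ 2 + 1) :> R.
  by rewrite mulr_gt0// ltr_wpDl ?sqr_ge0.
have [phi [tphi phi_eps]] := ag _ (divr_gt0 eps0 a0).
have [psi [tpsi psi_eps]] := ah _ (divr_gt0 eps0 (ltr0n R 4)).
exists (fun x => a * phi x + psi x); split; first exact: test_function_lin.
have Lphi := smooth_L2 tphi.1; have Lpsi := smooth_L2 tpsi.1.
have L2B (f k : 'rV[R]_d -> R) : L2 D f -> L2 D k -> L2 D (fun x => f x - k x).
  move=> Lf Lk; have := L2_lin (-1) Lk Lf.
  by congr (L2 D _); apply/funext => x; rewrite mulN1r addrC.
have lin_le (f k f' k' : 'rV[R]_d -> R) :
    L2 D f -> L2 D k -> L2 D f' -> L2 D k' ->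
    L2norm D (fun x => a * f x + k x - (a * f' x + k' x)) ^+ 2 <=
    2 * (a ^+ 2 * L2norm D (fun x => f x - f' x) ^+ 2 +
         L2norm D (fun x => k x - k' x) ^+ 2).
  move=> Lf Lk Lf' Lk'.
  have := L2norm_lin_le mD a (L2B _ _ Lf Lf') (L2B _ _ Lk Lk').
  by congr (L2norm D _ ^+ 2 <= _); apply/funext => x; ring.
set A := _ ^+ 2 + _ in phi_eps; set B := _ ^+ 2 + _ in psi_eps.
apply: (@le_lt_trans _ _ (2 * (a ^+ 2 * A + B))).
  rewrite /A /B [leRHS](_ : _ =
     2 * (a ^+ 2 * L2norm D (fun x => u x - phi x) ^+ 2 +
          L2norm D (fun x => w x - psi x) ^+ 2) +
     \sum_i 2 * (a ^+ 2 * L2norm D (fun x => g i x - partial i phi x) ^+ 2 +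
          L2norm D (fun x => h i x - partial i psi x) ^+ 2)).
    apply: lerD; first exact: lin_le.
    apply: ler_sum => i _; rewrite partial_lin; last 2 first.
    - by move=> x; exact: (tphi.1 [::]).
    - by move=> x; exact: (tpsi.1 [::]).
    by apply: lin_le => //; [exact: smooth_partial_L2 tphi.1
                            |exact: smooth_partial_L2 tpsi.1].
  by rewrite -mulr_sumr big_split /= -mulr_sumr; ring.
rewrite ltr_pdivlMr// in phi_eps; rewrite ltr_pdivlMr// in psi_eps.
have A0 : 0 <= A by rewrite addr_ge0 ?sqr_ge0// sumr_ge0// => i _; rewrite sqr_ge0.
nra.
Qed.

Lemma Hdiv_lin a v v' : Hdiv D v -> Hdiv D v' -> Hdiv D (fun x => a *: v x + v' x).
Proof.
move=> [Lv [g [Lg wg]]] [Lv' [h [Lh wh]]]; split=> [i|].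
  by under eq_fun do rewrite !mxE; exact: L2_lin.
exists (fun x => a * g x + h x); split=> [|phi tphi]; first exact: L2_lin.
have int (z : 'rV[R]_d -> 'rV[R]_d) : L2field z ->
    mu.-integrable D (EFin \o (fun x => \sum_i z x 0 i * partial i phi x)).
  move=> Lz; rewrite (_ : EFin \o _ =
      fun x => (\sum_i (z x 0%R i * partial i phi x)%:E)%E).
    apply: integrable_sum => // i _.
    by apply: L2_integrableM => //; exact: smooth_partial_L2 tphi.1.
  by apply/funext => x /=; rewrite sumEFin.
apply: (green_lin Lg Lh tphi.1 (int _ Lv) (int _ Lv')) => [x||].
- rewrite mulr_sumr -big_split/=; apply: eq_bigr => i _.
  by rewrite !mxE mulrDl mulrA.
- exact: wg.
- exact: wh.
Qed.

(** [D'] is kept general to cover both [Hcurl] ([D' = D]) and the vanishing tangential trace in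
    [H0curl] ([D' = setT]), where one curl satisfies both formulas. *)
Lemma curl_formula_lin D' a v v' (g h : 'I_d -> 'I_d -> 'rV[R]_d -> R) :
  L2field v -> L2field v' -> curl_formula D' D v g -> curl_formula D' D v' h ->
  curl_formula D' D (fun x => a *: v x + v' x) (fun i j x => a * g i j x + h i j x).
Proof.
move=> Lv Lv' [Lg wg] [Lh wh].
split=> [i j ij|i j phi ij tphi]; first exact: L2_lin (Lg _ _ ij) (Lh _ _ ij).
have int (z : 'rV[R]_d -> 'rV[R]_d) : L2field z ->
    mu.-integrable D (EFin \o
      (fun x => z x 0 j * partial i phi x - z x 0 i * partial j phi x)).
  move=> Lz; have Lp k := smooth_partial_L2 k tphi.1.
  exact: (integrableB mD (L2_integrableM mD (Lz j) (Lp i))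
                         (L2_integrableM mD (Lz i) (Lp j))).
apply: (green_lin (Lg i j ij) (Lh i j ij) tphi.1 (int _ Lv) (int _ Lv')) => [x||].
- by rewrite !mxE; ring.
- exact: wg.
- exact: wh.
Qed.

Lemma Hcurl_lin a v v' :
  Hcurl D v -> Hcurl D v' -> Hcurl D (fun x => a *: v x + v' x).
Proof.
move=> [Lv [g wg]] [Lv' [h wh]]; split=> [i|].
  by under eq_fun do rewrite !mxE; exact: L2_lin.
by exists (fun i j x => a * g i j x + h i j x); exact: curl_formula_lin.
Qed.

Lemma H0curl_lin a v v' :
  H0curl D v -> H0curl D v' -> H0curl D (fun x => a *: v x + v' x).
Proof.
move=> [Lv [g [wg wg']]] [Lv' [h [wh wh']]]; split=> [i|].
  by under eq_fun do rewrite !mxE; exact: L2_lin.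
by exists (fun i j x => a * g i j x + h i j x); split; exact: curl_formula_lin.
Qed.

Lemma measurable_partial i phi : smooth phi -> measurable_fun D (partial i phi).
Proof. by move=> sphi; apply: L2_measurable => //; exact: smooth_partial_L2. Qed.

Lemma H10_ae0 u : measurable_fun D u -> u = (fun=> 0) %[ae mu in D] -> H10 D u.
Proof.
move=> mu_ u0; split; first exact: L2_ae0.
exists (fun=> (fun=> 0)); split.
  split=> [i|i phi tphi]; first exact: L2_cst0.
  apply: green_ae0.
    by apply: measurable_funM => //; exact: measurable_partial tphi.1.
  by apply: filterS u0 => x /[apply] ->; rewrite mul0r.
move=> eps eps0; exists (fun=> 0); split; first exact: test_function0.
rewrite ae0_L2norm//; last 2 first.
- by under eq_fun do rewrite subr0.
- by apply: filterS u0 => x /[apply] ->; rewrite subr0.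
rewrite big1 ?expr0n ?addr0// => i _.
rewrite (_ : (fun x => 0 - _) = fun=> 0).
  by rewrite ae0_L2norm ?expr0n//; exact: aeW.
by apply/funext => x; rewrite /partial derive_cst subr0.
Qed.

Let field_ae0 v i : v = (fun=> 0) %[ae mu in D] ->
  (fun x => v x 0 i) = (fun=> 0) %[ae mu in D].
Proof. by apply: filterS => x /[apply] ->; rewrite mxE. Qed.

Lemma Hdiv_ae0 v : (forall i, measurable_fun D (fun x => v x 0 i)) ->
  v = (fun=> 0) %[ae mu in D] -> Hdiv D v.
Proof.
move=> mv v0; split=> [i|]; first by apply: L2_ae0 => //; exact: field_ae0.
exists (fun=> 0); split=> [|phi tphi]; first exact: L2_cst0.
apply: green_ae0.
  apply: measurable_sum => i.
  by apply: measurable_funM => //; exact: measurable_partial tphi.1.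
by apply: filterS v0 => x /[apply] ->; rewrite big1// => i _; rewrite mxE mul0r.
Qed.

Lemma curl_formula_ae0 D' v : (forall i, measurable_fun D (fun x => v x 0 i)) ->
  v = (fun=> 0) %[ae mu in D] -> curl_formula D' D v (fun _ _ _ => 0).
Proof.
move=> mv v0; split=> [*|i j phi ij tphi]; first exact: L2_cst0.
apply: green_ae0.
  by apply: measurable_funB; apply: measurable_funM => //;
    exact: measurable_partial tphi.1.
by apply: filterS v0 => x /[apply] ->; rewrite !mxE !mul0r subr0.
Qed.

Lemma Hcurl_ae0 v : (forall i, measurable_fun D (fun x => v x 0 i)) ->
  v = (fun=> 0) %[ae mu in D] -> Hcurl D v.
Proof.
move=> mv v0; split=> [i|]; first by apply: L2_ae0 => //; exact: field_ae0.
by exists (fun _ _ _ => 0); exact: curl_formula_ae0.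
Qed.

Lemma H0curl_ae0 v : (forall i, measurable_fun D (fun x => v x 0 i)) ->
  v = (fun=> 0) %[ae mu in D] -> H0curl D v.
Proof.
move=> mv v0; split=> [i|]; first by apply: L2_ae0 => //; exact: field_ae0.
by exists (fun _ _ _ => 0); split; exact: curl_formula_ae0.
Qed.

End weak_derivatives.

Lemma linear_entry (R : pzRingType) m n a (A B : 'M[R]_(m, n)) i j :
  (a *: A + B) i j = a * A i j + B i j.
Proof. by rewrite !mxE. Qed.

(** * The product spaces as linear subspaces, and their piecewise affine structure *)

Section function_spaces_linear.
Context (R : realType) (d : nat) (D : set 'rV[R]_d) (T : set (set 'rV[R]_d)).
Hypotheses (oD : open D) (bD : bounded_set D).
Implicit Types (u w : 'rV[R]_d -> R) (v : 'rV[R]_d -> 'rV[R]_d).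
Local Notation mu := (lebesgue_rV R d).
Local Notation field c := ('rV[R]_d -> 'rV[R]_(fosls_dim c d)).

Lemma S1_lin a u w : S1 T D u -> S1 T D w -> S1 T D (fun x => a * u x + w x).
Proof.
move=> [u' [cu' au' uu']] [w' [cw' aw' ww']].
exists (fun x => a * u' x + w' x); split.
- move=> x; apply: cvgD; last exact: cw'.
  by apply: cvgM; [exact: cvg_cst|exact: cu'].
- move=> K TK; have [p [b pb]] := au' K TK; have [q [e qe]] := aw' K TK.
  exists (a *: p + q), (a * b + e) => x Kx; rewrite pb// qe//.
  under [in RHS]eq_bigr do rewrite !mxE mulrDl -mulrA.
  by rewrite big_split /= -mulr_sumr; ring.
- by apply: filterS2 uu' ww' => x + + Dx => -> // ->.
Qed.

Lemma S1_ae0 u : u = (fun=> 0) %[ae mu in D] -> S1 T D u.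
Proof.
move=> u0; exists (fun=> 0); split=> //; first by move=> x; exact: cvg_cst.
move=> K TK; exists 0, 0 => x _; rewrite addr0 big1// => i _.
by rewrite mxE mul0r.
Qed.

Lemma RT0_lin a v v' : RT0 T D v -> RT0 T D v' -> RT0 T D (fun x => a *: v x + v' x).
Proof.
move=> [Hv av] [Hv' av']; split; first exact: Hdiv_lin.
move=> K TK; have [p [b pb]] := av K TK; have [q [e qe]] := av' K TK.
exists (a *: p + q), (a * b + e).
apply: filterS2 pb qe => x + + Dx => -> // -> //.
by rewrite scalerDr scalerDl scalerA addrACA.
Qed.

Lemma RT0_ae0 v : (forall i, measurable_fun D (fun x => v x 0 i)) ->
  v = (fun=> 0) %[ae mu in D] -> RT0 T D v.
Proof.
move=> mv v0; split; first exact: Hdiv_ae0.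
move=> K TK; exists 0, 0; apply: filterS v0 => x + [Dx _] => -> //.
by rewrite scale0r addr0.
Qed.

Lemma N0_lin a v v' : N0 T D v -> N0 T D v' -> N0 T D (fun x => a *: v x + v' x).
Proof.
move=> [Hv av] [Hv' av']; split; first exact: Hcurl_lin.
move=> K TK; have [p [B [BT pB]]] := av K TK; have [q [C [CT qC]]] := av' K TK.
exists (a *: p + q), (a *: B + C); split.
  by rewrite linearP /= BT CT scalerN opprD.
apply: filterS2 pB qC => x + + Dx => -> // -> //.
by rewrite scalerDr mulmxDr -scalemxAr addrACA.
Qed.

Lemma N0_ae0 v : (forall i, measurable_fun D (fun x => v x 0 i)) ->
  v = (fun=> 0) %[ae mu in D] -> N0 T D v.
Proof.
move=> mv v0; split; first exact: Hcurl_ae0.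
move=> K TK; exists 0, 0; split; first by rewrite trmx0 oppr0.
by apply: filterS v0 => x + [Dx _] => -> //; rewrite mulmx0 addr0.
Qed.

Lemma sobolev_space_lin c a (v w : field c) : sobolev_space c D v ->
  sobolev_space c D w -> sobolev_space c D (fun x => a *: v x + w x).
Proof.
case: c v w => v w /=.
- move=> [v1 v2] [w1 w2]; split.
    by under eq_fun do rewrite linearP linear_entry; exact: H10_lin.
  by under eq_fun do rewrite linearP; exact: Hdiv_lin.
- move=> vH wH i; have [v1 v2] := vH i; have [w1 w2] := wH i; split.
    by under eq_fun do rewrite linearP linear_entry; exact: H10_lin.
  by under eq_fun do rewrite !linearP; exact: Hdiv_lin.
- move=> [v1 v2] [w1 w2]; split.
    by under eq_fun do rewrite linearP; exact: H0curl_lin.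
  by under eq_fun do rewrite linearP; exact: Hcurl_lin.
Qed.

Lemma fe_space_lin c a (v w : field c) : fe_space c T D v ->
  fe_space c T D w -> fe_space c T D (fun x => a *: v x + w x).
Proof.
case: c v w => v w /=.
- move=> [[v1 v1'] v2] [[w1 w1'] w2]; split.
    under eq_fun do rewrite linearP linear_entry.
    by split; [exact: S1_lin|exact: H10_lin].
  by under eq_fun do rewrite linearP; exact: RT0_lin.
- move=> vH wH i; have [[v1 v1'] v2] := vH i; have [[w1 w1'] w2] := wH i; split.
    under eq_fun do rewrite linearP linear_entry.
    by split; [exact: S1_lin|exact: H10_lin].
  by under eq_fun do rewrite !linearP; exact: RT0_lin.
- move=> [[v1 v1'] v2] [[w1 w1'] w2]; split.
    by under eq_fun do rewrite linearP; split; [exact: N0_lin|exact: H0curl_lin].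
  by under eq_fun do rewrite linearP; exact: N0_lin.
Qed.

Lemma fe_sub_sobolev c : fe_space c T D `<=` sobolev_space c D.
Proof.
case: c => v /=.
- by move=> [[_ v1] [v2 _]].
- by move=> vH i; have [[_ v1] [v2 _]] := vH i.
- by move=> [[_ v1] [v2 _]].
Qed.

Lemma fe_space_ae0 c (v : field c) :
  (forall i, measurable_fun D (fun x => v x 0 i)) ->
  v = (fun=> 0) %[ae mu in D] -> fe_space c T D v.
Proof.
case: c v => v mv v0 /=.
- split.
    have z0 : (fun x => lsubmx (v x) 0 0) = (fun=> 0) %[ae mu in D].
      by apply: filterS v0 => x /[apply] ->; rewrite !mxE.
    split; first exact: S1_ae0.
    by apply: H10_ae0 => //; under eq_fun do rewrite mxE; exact: mv.
  apply: RT0_ae0; first by move=> i; under eq_fun do rewrite mxE; exact: mv.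
  by apply: filterS v0 => x /[apply] ->; rewrite linear0.
- move=> i; split.
    have z0 : (fun x => lsubmx (v x) 0 i) = (fun=> 0) %[ae mu in D].
      by apply: filterS v0 => x /[apply] ->; rewrite !mxE.
    split; first exact: S1_ae0.
    by apply: H10_ae0 => //; under eq_fun do rewrite mxE; exact: mv.
  apply: RT0_ae0; first by move=> j; under eq_fun do rewrite !mxE; exact: mv.
  by apply: filterS v0 => x /[apply] ->; rewrite !linear0.
- have l0 : (fun x => lsubmx (v x)) = (fun=> 0) %[ae mu in D].
    by apply: filterS v0 => x /[apply] ->; rewrite linear0.
  have ml i : measurable_fun D (fun x => lsubmx (v x) 0 i).
    by under eq_fun do rewrite mxE; exact: mv.
  split; first by split; [exact: N0_ae0|exact: H0curl_ae0].
  apply: N0_ae0; first by move=> i; under eq_fun do rewrite mxE; exact: mv.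
  by apply: filterS v0 => x /[apply] ->; rewrite linear0.
Qed.

Lemma sobolev_space_ae0 c (v : field c) :
  (forall i, measurable_fun D (fun x => v x 0 i)) ->
  v = (fun=> 0) %[ae mu in D] -> sobolev_space c D v.
Proof. by move=> mv v0; exact/fe_sub_sobolev/fe_space_ae0. Qed.

Lemma fe_space_subspace c : linear_subspace (fe_space c T D).
Proof.
split; last exact: fe_space_lin.
apply: fe_space_ae0; last exact: aeW.
by move=> i; under eq_fun do rewrite mxE; exact: measurable_cst.
Qed.

Lemma sobolev_space_subspace c : linear_subspace (sobolev_space c D).
Proof.
split; last exact: sobolev_space_lin.
exact/fe_sub_sobolev/(fe_space_subspace c).1.
Qed.

Lemma sobolev_space_measurable c (v : field c) i :
  sobolev_space c D v -> measurable_fun D (fun x => v x 0 i).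
Proof.
have mD := open_measurable_rV oD.
case: c v i => v i /=.
- move=> [[v1 _] [v2 _]]; case: (split_ordP i) => j ->.
    have -> : j = 0 by exact/ord1.
    by have := L2_measurable mD v1; under eq_fun do rewrite mxE.
  by have := L2_measurable mD (v2 j); under eq_fun do rewrite mxE.
- move=> vH; case: (split_ordP i) => j ->.
    have [[v1 _] _] := vH j.
    by have := L2_measurable mD v1; under eq_fun do rewrite mxE.
  case/mxvec_indexP: j => k l; have [_ [v2 _]] := vH k.
  by have := L2_measurable mD (v2 l); under eq_fun do rewrite !mxE.
- move=> [[v1 _] [v2 _]]; case: (split_ordP i) => j ->.
    by have := L2_measurable mD (v1 j); under eq_fun do rewrite mxE.
  by have := L2_measurable mD (v2 j); under eq_fun do rewrite mxE.
Qed.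

(** [R^o] is [R] as a vector space over itself, so that the coefficient pairs form a [vectType]. *)
Definition affine_fun (p : 'rV[R]_d * R^o) (x : 'rV[R]_d) : R :=
  \sum_i p.1 0 i * x 0 i + p.2.

Lemma affine_fun_lin a p q x :
  affine_fun (a *: p + q) x = a * affine_fun p x + affine_fun q x.
Proof.
rewrite /affine_fun /=; under eq_bigr do rewrite !mxE mulrDl -mulrA.
by rewrite big_split/= -mulr_sumr mulrDr addrACA.
Qed.

(** Serves both vector-valued elements: [B] is scalar for [RT0] and antisymmetric for [N0]. Column
    [j] of [B] is the gradient of component [j]. *)
Lemma affine_field_component (A : set 'rV[R]_d) v a (B : 'M[R]_d) j :
  v = (fun x => a + x *m B) %[ae mu in A] ->
  exists p, (fun x => v x 0 j) = affine_fun p %[ae mu in A].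
Proof.
move=> vaB; exists (\row_i B i j, a 0 j).
apply: filterS vaB => x /[apply] ->; rewrite /affine_fun !mxE addrC; congr (_ + _).
by apply: eq_bigr => i _; rewrite mxE mulrC.
Qed.

Lemma S1_piecewise_affine u K : S1 T D u -> T K ->
  exists p, u = affine_fun p %[ae mu in D `&` K].
Proof.
move=> [w [_ aw uw]] TK; have [a [b ab]] := aw K TK.
by exists (a, b); apply: filterS uw => x + [Dx Kx] => ->//; exact: ab.
Qed.

Lemma RT0_piecewise_affine v K j : RT0 T D v -> T K ->
  exists p, (fun x => v x 0 j) = affine_fun p %[ae mu in D `&` K].
Proof.
move=> [_ av] TK; have [a [b ab]] := av K TK.
apply: (@affine_field_component _ _ a b%:M).
by apply: filterS ab => x /[apply] ->; rewrite mul_mx_scalar.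
Qed.

Lemma N0_piecewise_affine v K j : N0 T D v -> T K ->
  exists p, (fun x => v x 0 j) = affine_fun p %[ae mu in D `&` K].
Proof.
move=> [_ av] TK; have [a [B [_ aB]]] := av K TK.
exact: affine_field_component aB.
Qed.

Lemma fe_space_piecewise_affine c (v : field c) K j : fe_space c T D v -> T K ->
  exists p, (fun x => v x 0 j) = affine_fun p %[ae mu in D `&` K].
Proof.
case: c v j => v j /= + TK.
- move=> [[v1 _] v2]; case: (split_ordP j) => i ->.
    have -> : i = 0 by exact/ord1.
    have [p vp] := S1_piecewise_affine v1 TK; exists p.
    by apply: filterS vp => x /[apply] <-; rewrite mxE.
  have [p vp] := RT0_piecewise_affine i v2 TK; exists p.
  by apply: filterS vp => x /[apply] <-; rewrite mxE.
- move=> vH; case: (split_ordP j) => i ->.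
    have [[v1 _] _] := vH i.
    have [p vp] := S1_piecewise_affine v1 TK; exists p.
    by apply: filterS vp => x /[apply] <-; rewrite mxE.
  case/mxvec_indexP: i => k l; have [_ v2] := vH k.
  have [p vp] := RT0_piecewise_affine l v2 TK; exists p.
  by apply: filterS vp => x /[apply] <-; rewrite !mxE.
- move=> [[v1 _] v2]; case: (split_ordP j) => i ->.
    have [p vp] := N0_piecewise_affine i v1 TK; exists p.
    by apply: filterS vp => x /[apply] <-; rewrite mxE.
  have [p vp] := N0_piecewise_affine i v2 TK; exists p.
  by apply: filterS vp => x /[apply] <-; rewrite mxE.
Qed.

End function_spaces_linear.

(** * Neural networks and least squares *)

Section realization_measurability.
Context (R : realType).

Lemma measurable_bisu : measurable_fun setT (@bisu R).
Proof.
apply: measurable_fun_ifT => //.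
apply: (measurable_fun_bool true).
rewrite setTI (_ : _ @^-1` _ = `]0, +oo[%classic); first exact: measurable_itv.
by apply/seteqP; split=> x /=; rewrite in_itv /= andbT.
Qed.

Lemma measurable_relu : measurable_fun setT (@relu R).
Proof. exact: measurable_maxr. Qed.

Lemma measurable_affine_layer p q (A : 'M[R]_(q, p)) (b : 'rV[R]_q) j :
  measurable_fun setT (fun x : 'rV[R]_p => (x *m A^T + b) 0 j).
Proof.
under eq_fun do rewrite !mxE.
apply: measurable_funD => //; apply: measurable_sum => i.
by apply: measurable_funM => //; exact: measurable_coord.
Qed.

Lemma measurable_realization p q (Phi : network R p q) :
  relu_bisu Phi -> measurable_fun setT (realization Phi).
Proof.
elim: Phi => {p q} [p q A b _|p q k A b rho Psi ih /= [rhoE /ih mPsi]].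
  by apply: measurable_fun_rVP => j; exact: measurable_affine_layer.
apply: (measurableT_comp mPsi); apply: measurable_fun_rVP => j.
under eq_fun do rewrite mxE.
have mrho : measurable_fun setT (rho j).
  by case: (rhoE j) => ->; [exact: measurable_relu|exact: measurable_bisu].
exact: (measurableT_comp mrho (measurable_affine_layer A b j)).
Qed.

End realization_measurability.

Section fe_best_approximation.
Context (R : realType) (d : nat) (D : set 'rV[R]_d) (T : set (set 'rV[R]_d)).
Hypotheses (oD : open D) (bD : bounded_set D).
Hypotheses (finT : finite_set T) (covT : D `<=` \bigcup_(K in T) K).
Variable c : fosls_case.
Local Notation mu := (lebesgue_rV R d).
Local Notation E := ('rV[R]_d -> 'rV[R]_(fosls_dim c d)).
Local Notation V := (sobolev_space c D).
Local Notation W := (fe_space c T D).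

(* The elements of [W] are determined a.e. by the coefficients of their affine
   pieces, hence [W] is finite-dimensional up to null functions. *)
Lemma fe_best_approximation (ip : E -> E -> R) : semi_inner V ip ->
  (forall v, V v -> v = (fun=> 0) %[ae mu in D] -> ip v v = 0) ->
  forall u, V u -> exists2 w, W w & forall v, W v ->
    ip (u - v) (u - v) = ip (u - w) (u - w) + ip (w - v) (w - v).
Proof.
move=> ipV ip_null.
have [s Ts] : exists s : seq (set 'rV[R]_d), T = [set` s] by exact/finite_seqP.
pose I := ('I_(size s) * 'I_(fosls_dim c d))%type.
pose K (k : I) := nth set0 s k.1.
have TK k : T (K k) by rewrite Ts /= mem_nth.
(* One affine piece per pair of a simplex and a scalar component. *)
pose rep (v : E) (p : {ffun I -> 'rV[R]_d * R^o}) := forall k : I,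
  (fun x => v x 0 k.2) = affine_fun (p k) %[ae mu in D `&` K k].
have sV := @sobolev_space_subspace _ _ _ T oD bD c.
have sW := @fe_space_subspace _ _ _ T oD bD c.
apply: (@best_approximation _ _ V ip sV ipV W _ rep) => //.
- exact: fe_sub_sobolev.
- move=> v Wv.
  have /choice[p vp] : forall k : I, exists p,
      (fun x => v x 0 k.2) = affine_fun p %[ae mu in D `&` K k].
    by move=> k; exact: fe_space_piecewise_affine Wv (TK k).
  exists (finfun p) => k; apply: filterS (vp k) => x /[apply] ->.
  by rewrite ffunE.
- move=> a u v p q Wu Wv up vq k; apply: filterS2 (up k) (vq k) => x + + DKx.
  by move=> /(_ DKx) ux /(_ DKx) vx; rewrite !ffunE affine_fun_lin linear_entry ux vx.
- move=> v Wv v0; apply: ip_null; first exact: fe_sub_sobolev Wv.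
  (* [I] is finite, so the exceptional null sets merge into one; as the simplices cover [D], all of
     [v] vanishes off it. *)
  have : \forall x \ae mu, forall k : I, (D `&` K k) x -> v x 0 k.2 = 0.
    apply: filter_forall => k; apply: filterS (v0 k) => x /[apply] ->.
    by rewrite /affine_fun ffunE /= big1 ?addr0// => i _; rewrite mxE mul0r.
  apply: filterS => x vx Dx; apply/rowP => j; rewrite mxE.
  have [L + Lx] := covT Dx; rewrite Ts /= => sL.
  have iL : (index L s < size s)%N by rewrite index_mem.
  by apply: (vx (Ordinal iL, j)); split=> //; rewrite /K /= nth_index.
Qed.

End fe_best_approximation.

(** * The residual as a semi-inner product pulled back by the operator *)

Section operator_inner_product.
Context (R : realType) (n : nat) (e : 'I_n -> nat).
Variables (Ds : forall i, set 'rV[R]_(e i)).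
Arguments Ds : clear implicits.
Hypothesis mDs : forall i, measurable (Ds i).
Context (X : Type) (m : nat).
Variables (V : set (X -> 'rV[R]_m)) (L : (X -> 'rV[R]_m) -> forall i, 'rV[R]_(e i) -> R).
Arguments L : clear implicits.
Hypotheses (sV : linear_subspace V) (linL : linear_operator Ds V L).

Definition L2prod_ip (f g : forall i, 'rV[R]_(e i) -> R) : R :=
  \sum_i \int[lebesgue_rV R (e i)]_(x in Ds i) (f i x * g i x).

Lemma L2prod_normE f : L2prod Ds f -> L2prod_norm Ds f = Num.sqrt (L2prod_ip f f).
Proof.
by move=> Lf; congr Num.sqrt; apply: eq_bigr => i _; rewrite L2norm_sqr.
Qed.

(** [L] is linear only up to null sets, so linearity of the form passes through a.e. equality of
    integrands, for which both sides must be measurable. *)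
Lemma operator_semi_inner : semi_inner V (fun v w => L2prod_ip (L v) (L w)).
Proof.
split=> [v w _ _|a u v w Vu Vv Vw|v Vv].
- by apply: eq_bigr => i _; apply: eq_Rintegral => x _; rewrite mulrC.
- rewrite mulr_sumr -big_split; apply: eq_bigr => i _ /=.
  have [Lu Lv Lw] := And3 (linL.1 _ Vu i) (linL.1 _ Vv i) (linL.1 _ Vw i).
  rewrite -RintegralL//; [|exact: L2_integrableM..].
  have Luv := linL.1 _ (sV.2 a _ _ Vu Vv) i.
  apply: ae_eq_Rintegral => //.
  + by apply: measurable_funM; apply: L2_measurable.
  + have mM f g : L2 (Ds i) f -> L2 (Ds i) g -> measurable_fun (Ds i) (f \* g).
      by move=> Lf Lg; apply: measurable_funM; exact: L2_measurable.
    by apply: measurable_funD; [apply: measurable_funM => //|]; exact: mM.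
  + apply: filterS (linL.2 a _ _ Vu Vv i) => x /[apply] ->.
    by rewrite mulrDl mulrA.
- by apply: sumr_ge0 => i _; apply: Rintegral_ge0 => x _; rewrite -expr2 sqr_ge0.
Qed.

Lemma residualE F U r : V U -> V r -> L2prod Ds F -> L2prod_eq Ds (L U) F ->
  L2prod_norm Ds (fun i y => F i y - L r i y) =
  Num.sqrt (L2prod_ip (L (U - r)) (L (U - r))).
Proof.
move=> VU Vr LF UF; have LUr := linL.1 _ (subspaceB sV VU Vr).
rewrite -L2prod_normE//.
congr Num.sqrt; apply: eq_bigr => i _; congr (_ ^+ 2).
apply: ae_eq_L2norm => //.
- have := L2_lin (-1) (linL.1 _ Vr i) (LF i).
  by congr (L2 _ _); apply/funext => x; rewrite mulN1r addrC.
(* The shape required by [linear_operator]. *)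
- have -> : U - r = fun x => -1 *: r x + U x.
    by apply/funext => x; rewrite scaleN1r addrC.
  apply: filterS2 (linL.2 (-1) _ _ Vr VU i) (UF i) => y + + Dy.
  by move=> /(_ Dy) -> /(_ Dy) ->; rewrite mulN1r addrC.
Qed.

End operator_inner_product.

Theorem mainTheorem3 (R : realType) (d : nat) (d_ge2 : (2 <= d)%N)
    (D : set 'rV[R]_d) (domD : polytopal_lipschitz_domain D)
    (T : set (set 'rV[R]_d)) (trT : regular_triangulation D T)
    (c : fosls_case) (curl_le3 : c = CurlCurl -> (d <= 3)%N)
    (normV : ('rV[R]_d -> 'rV[R]_(fosls_dim c d)) -> R)
    (hilbV : hilbertian_norm c D normV)
    (n : nat) (n_ge1 : (1 <= n)%N)
    (e : 'I_n -> nat) (e_ge1 : forall i, (1 <= e i)%N)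
    (Ds : forall i, set 'rV[R]_(e i))
    (domDs : forall i, polytopal_lipschitz_domain (Ds i))
    (L : ('rV[R]_d -> 'rV[R]_(fosls_dim c d)) ->
         forall i, 'rV[R]_(e i) -> R)
    (linL : linear_operator Ds (sobolev_space c D) L)
    (cL CL : R) (cL_gt0 : 0 < cL) (cL_le_CL : cL <= CL)
    (boundL : forall v, sobolev_space c D v ->
       cL * normV v <= L2prod_norm Ds (L v) <= CL * normV v)
    (F : forall i, 'rV[R]_(e i) -> R) (FL2 : L2prod Ds F)
    (rangeF : exists2 v, sobolev_space c D v & L2prod_eq Ds (L v) F)
    (U : 'rV[R]_d -> 'rV[R]_(fosls_dim c d)) (VU : sobolev_space c D U)
    (LU : L2prod_eq Ds (L U) F)
    (Phi : ('rV[R]_d -> 'rV[R]_(fosls_dim c d)) -> network R d (fosls_dim c d))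
    (nnPhi : fosls_networks D (fe_space c T D) Phi) :
  let NN := Phi @` fe_space c T D in
  let residual (Psi : network R d (fosls_dim c d)) :=
    L2prod_norm Ds (fun i y => F i y - L (realization Psi) i y) in
  let error v := normV (fun x => U x - v x) in
  let minimizer Psi :=
    NN Psi /\ forall Psi', NN Psi' -> residual Psi ^+ 2 <= residual Psi' ^+ 2 in
  exists Phi_opt,
    [/\ minimizer Phi_opt,
        forall Psi, minimizer Psi -> Psi = Phi_opt
      & exists mF mNN mV : R,
        [/\ is_min [set residual Psi | Psi in NN] mF,
            is_min [set error (realization Psi) | Psi in NN] mNN
          & is_min [set error v | v in fe_space c T D] mV] /\
        [/\ cL * error (realization Phi_opt) <= residual Phi_opt,
            residual Phi_opt = mF,
            mF <= CL * mNN
          & CL * mNN = CL * mV]].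
Proof.
move=> NN residual error minimizer.
have [oD bD _ _ _] := domD; have [finT _ covT _ _] := trT.
have DT : D `<=` \bigcup_(K in T) K by rewrite covT; exact: subset_closure.
have mDs i : measurable (Ds i) by apply: open_measurable_rV; case: (domDs i).
have [realPhi PhiE] := nnPhi.
have [ip [ipC ipL ip_ge0 ip_eq0 [normVE _]]] := hilbV.
set V := sobolev_space c D in linL boundL VU ipC ipL ip_ge0 ip_eq0 normVE.
pose W := fe_space c T D.
have sV : linear_subspace V := @sobolev_space_subspace _ _ _ T oD bD c.
have sW : linear_subspace W := @fe_space_subspace _ _ _ T oD bD c.
have WV : W `<=` V by exact: fe_sub_sobolev.
have ipV : semi_inner V ip by split.
pose ipR v w := L2prod_ip Ds (L v) (L w).
have ipRV : semi_inner V ipR by exact: operator_semi_inner.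
have ipR_ge0 v : V v -> 0 <= ipR v v by case: ipRV => _ _; exact.
have L_normE v : V v -> L2prod_norm Ds (L v) = Num.sqrt (ipR v v).
  by move=> Vv; apply: L2prod_normE => //; exact: linL.1.
(* The upper bound [CL] enters here: a null function has [normV] equal to 0, hence so has its image
   under [L]. *)
have ipR_null v : V v -> v = (fun=> 0) %[ae lebesgue_rV R d in D] -> ipR v v = 0.
  move=> Vv v0; apply/eqP; rewrite eq_le ipR_ge0// andbT -sqrtr_eq0 -L_normE//.
  have /andP[_] := boundL _ Vv.
  rewrite normVE// (ip_eq0 _ Vv).2// sqrtr0 mulr0 => h.
  by rewrite eq_le h sqrtr_ge0.
have ip_null v : V v -> v = (fun=> 0) %[ae lebesgue_rV R d in D] -> ip v v = 0.
  by move=> Vv; exact: (ip_eq0 _ Vv).2.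
have real_null v : W v -> V (v - realization (Phi v)) /\
    v - realization (Phi v) = (fun=> 0) %[ae lebesgue_rV R d in D].
  move=> Wv; have [_ rbPhi Phiv] := realPhi _ Wv.
  have null : v - realization (Phi v) = (fun=> 0) %[ae lebesgue_rV R d in D].
    by apply: filterS Phiv => x /[apply] e'; rewrite -[LHS]/(v x - _) e' subrr.
  split=> //; apply: (@sobolev_space_ae0 _ _ _ T) => // i.
  have mv := sobolev_space_measurable oD i (WV _ Wv).
  have mr : measurable_fun D (fun x => realization (Phi v) x 0 i).
    apply: measurable_funTS.
    exact: (measurableT_comp (measurable_coord i) (measurable_realization rbPhi)).
  rewrite (_ : (fun x => _) = fun x => v x 0 i - realization (Phi v) x 0 i).
    exact: measurable_funB.
  by apply/funext => x; rewrite !mxE.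
have Vreal v : W v -> V (realization (Phi v)).
  move=> Wv; rewrite -[realization _](subKr v).
  by apply: subspaceB => //; [exact: WV|case: (real_null v Wv)].
have VB v : W v -> V (U - v) by move=> Wv; apply: subspaceB => //; exact: WV.
have ip_real q : semi_inner V q ->
    (forall v, V v -> v = (fun=> 0) %[ae lebesgue_rV R d in D] -> q v v = 0) ->
    forall v, W v -> q (U - realization (Phi v)) (U - realization (Phi v)) =
                     q (U - v) (U - v).
  move=> qV q_null v Wv; have [Vn n0] := real_null v Wv.
  rewrite -[U - realization _](subrKA v).
  exact: (ip_sqD_null sV qV (VB _ Wv) Vn (q_null _ Vn n0)).
have residual_fe v : W v -> residual (Phi v) = Num.sqrt (ipR (U - v) (U - v)).
  move=> Wv; rewrite /residual (residualE mDs sV linL VU (Vreal _ Wv) FL2 LU).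
  by congr Num.sqrt; exact: (ip_real _ ipRV ipR_null).
have errorE v : V (U - v) -> error v = Num.sqrt (ip (U - v) (U - v)).
  exact: normVE.
have error_real v : W v -> error (realization (Phi v)) = error v.
  move=> Wv; have VUr := subspaceB sV VU (Vreal _ Wv).
  rewrite (errorE _ VUr) (errorE _ (VB _ Wv)).
  by congr Num.sqrt; exact: (ip_real _ ipV ip_null).
(* Two projections of [U]: [w] minimizes the residual and [z] below the error; they differ in
   general. *)
have [w Ww wR] : exists2 w, W w & forall v, W v ->
    ipR (U - v) (U - v) = ipR (U - w) (U - w) + ipR (w - v) (w - v).
  exact (fe_best_approximation oD bD finT DT ipRV ipR_null VU).
have [z Wz zip] : exists2 z, W z & forall v, W v ->
    ip (U - v) (U - v) = ip (U - z) (U - z) + ip (z - v) (z - v).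
  exact (fe_best_approximation oD bD finT DT ipV ip_null VU).
have ipR_WB v v' : W v -> W v' -> 0 <= ipR (v - v') (v - v').
  by move=> Wv Wv'; apply/ipR_ge0/WV; exact: subspaceB.
have residual_min v : W v -> residual (Phi w) <= residual (Phi v).
  move=> Wv; rewrite !residual_fe// ler_sqrt; last exact/ipR_ge0/VB.
  by rewrite (wR v Wv) lerDl ipR_WB.
have error_min v : W v -> error z <= error v.
  move=> Wv; rewrite (errorE _ (VB _ Wz)) (errorE _ (VB _ Wv)).
  rewrite ler_sqrt; last exact/ip_ge0/VB.
  by rewrite (zip v Wv) lerDl; apply/ip_ge0/WV; exact: subspaceB.
have residual_ge0 Psi : 0 <= residual Psi by exact: sqrtr_ge0.
exists (Phi w); split.
- split; first by exists w.
  by move=> _ [v Wv <-]; rewrite lerXn2r ?nnegrE ?residual_min.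
- move=> _ [[v Wv <-] minv].
  have NNw : NN (Phi w) by exists w.
  have Vwv : V (w - v) by apply: WV; exact: subspaceB.
  (* Comparing the minimizer [v] with [w] forces the extra square in [wR] to vanish; [cL > 0] then
     gives [w - v] norm 0, so [w] and [v] agree a.e. and [Phi] sends them to the same network. *)
  have := minv _ NNw; rewrite ler_pXn2r ?nnegrE// !residual_fe//.
  rewrite ler_sqrt; last exact/ipR_ge0/VB.
  rewrite (wR v Wv) gerDl => ipR0.
  have {}ipR0 : ipR (w - v) (w - v) = 0 by apply/eqP; rewrite eq_le ipR0 ipR_WB.
  have /andP[+ _] := boundL _ Vwv.
  rewrite L_normE// ipR0 sqrtr0 pmulr_rle0// normVE// => h.
  have : Num.sqrt (ip (w - v) (w - v)) == 0 by rewrite eq_le h sqrtr_ge0.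
  rewrite sqrtr_eq0 => h'.
  have /(ip_eq0 _ Vwv).1 wv : ip (w - v) (w - v) = 0.
    by apply/eqP; rewrite eq_le h' ip_ge0.
  apply: PhiE => //; apply: filterS wv => x /[apply] /eqP.
  by rewrite subr_eq0 => /eqP.
- exists (residual (Phi w)), (error (realization (Phi z))), (error z); split; split.
  + split; first by exists (Phi w) => //; exists w.
    by move=> _ [_ [v Wv <-] <-]; exact: residual_min.
  + split; first by exists (Phi z) => //; exists z.
    by move=> _ [_ [v Wv <-] <-]; rewrite !error_real//; exact: error_min.
  + by split; [exists z|move=> _ [v Wv <-]; exact: error_min].
  + rewrite error_real// residual_fe// -(L_normE _ (VB _ Ww)).
    by have /andP[] := boundL _ (VB _ Ww).
  + by [].
  (* The residual minimizer is tested against [z], and the upper bound for [L] is applied to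
     [U - z]. *)
  + rewrite error_real// (le_trans (residual_min _ Wz))// residual_fe//.
    rewrite -(L_normE _ (VB _ Wz)).
    by have /andP[] := boundL _ (VB _ Wz).
  + by rewrite error_real.
Qed.
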